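(* Let $G_m$ be a bounded Vilenkin group. (a) Let $\{q_k:k\ge 0\}$ be a non-decreasing sequence of non-negative numbers with $q_0>0$ satisfying $$\frac{q_{n-1}}{Q_n}=O\left(\frac1n\right)\quad (n\to\infty),$$ let $T_n$ be the associated $T$ means and let $T^*f=\sup_{n\in\mathbb N_+}|T_nf|$. Then $T^*$ is bounded from the Hardy space $H_{1/2}(G_m)$ to the space weak-$L_{1/2}(G_m)$; that is, there is a constant $C$ such that $\|T^*f\|_{weak-L_{1/2}}\le C\|f\|_{H_{1/2}}$ for all $f\in H_{1/2}(G_m)$. (b) Let $0<p<1/2$. For any non-decreasing sequence $\{q_k:k\ge 0\}$ of non-negative numbers with $q_0>0$, there exists a martingale $f\in H_p(G_m)$ such that $$\sup_{n\in\mathbb N_+}\|T_nf\|_{weak-L_p}=\infty .$$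
   Context: Notation: $\mathbb N_+=\{1,2,\dots\}$, $\mathbb N=\mathbb N_+\cup\{0\}$. Let $m=(m_0,m_1,\dots)$ be a sequence of integers $m_k\ge 2$ with $\sup_k m_k<\infty$ (bounded case). $Z_{m_k}=\{0,\dots,m_k-1\}$ is the additive group of integers modulo $m_k$ with the discrete topology, and $G_m=\prod_{k\ge 0}Z_{m_k}$ with the product topology and the product measure $\mu$ of the uniform measures $\mu_k(\{j\})=1/m_k$ (normalized Haar measure). Elements are $x=(x_0,x_1,\dots)$ with $x_j\in Z_{m_j}$. Put $I_0(x)=G_m$, $I_n(x)=\{y\in G_m: y_0=x_0,\dots,y_{n-1}=x_{n-1}\}$. Put $M_0=1$, $M_{k+1}=m_kM_k$; each $n\in\mathbb N$ is uniquely $n=\sum_{j\ge 0}n_jM_j$ with $n_j\in Z_{m_j}$, finitely many nonzero. Generalized Rademacher functions: $r_k(x)=\exp(2\pi i x_k/m_k)$. Vilenkin system: $\psi_n(x)=\prod_{k\ge 0}r_k^{n_k}(x)$, $n\in\mathbb N$. For measurable $f$ and $0<p<\infty$: $\|f\|_{weak-L_p}^p=\sup_{\lambda>0}\lambda^p\mu(|f|>\lambda)$. Let $\mathcal F_n$ be the $\sigma$-algebra generated by $\{I_n(x):x\in G_m\}$. A martingale $f=(f^{(n)},n\in\mathbb N)$ is a martingale with respect to $(\mathcal F_n)$. For $0<p<\infty$, $H_p(G_m)$ consists of all martingales $f$ with $\|f\|_{H_p}:=\|f^*\|_p<\infty$, where $f^*=\sup_n|f^{(n)}|$ and $\|g\|_p=(\int_{G_m}|g|^pd\mu)^{1/p}$.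 The Vilenkin–Fourier coefficients of a martingale $f$ are $\widehat f(i)=\lim_{k\to\infty}\int_{G_m}f^{(k)}\overline{\psi}_i\,d\mu$, and the partial sums are $S_nf=\sum_{k=0}^{n-1}\widehat f(k)\psi_k$ for $n\in\mathbb N_+$, with $S_0f=0$. Given the sequence $\{q_k\}$, put $Q_n=\sum_{k=0}^{n-1}q_k$. The $T$ means are $T_nf=\frac1{Q_n}\sum_{k=0}^{n-1}q_kS_kf$, $n\in\mathbb N_+$. *)

(* Defs.v *)
From HB Require Import structures.
From mathcomp Require Import all_boot all_order all_algebra.
From mathcomp Require Import all_classical all_reals all_analysis.
From mathcomp Require Import complex.

Set Implicit Arguments.
Unset Strict Implicit.
Unset Printing Implicit Defensive.

Import Order.TTheory GRing.Theory Num.Theory.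
Import numFieldNormedType.Exports.

Local Open Scope classical_set_scope.
Local Open Scope ring_scope.

(* As [1 < m k] is assumed throughout, ['Z_(m k)] is [{0, ..., m k - 1}]. *)
Definition vseq (m : nat -> nat) : Type := forall k, 'Z_(m k).
HB.instance Definition _ m := Choice.on (vseq m).
HB.instance Definition _ m := isPointed.Build (vseq m) (fun=> 0).

(* The set I_n(x). *)
Definition vcyl (m : nat -> nat) (n : nat) (x : vseq m) : set (vseq m) :=
  [set y | forall k, (k < n)%N -> y k = x k].

Definition vcyls (m : nat -> nat) (n : nat) : set (set (vseq m)) :=
  range (@vcyl m n).

(* The cylinders are a countable base of the product topology, so these are the
   Borel sets of G_m, i.e. the product sigma-algebra. *)
Definition Gm (m : nat -> nat) : Type :=
  g_sigma_algebraType (\bigcup_n @vcyls m n).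

(* [mu] is the product of the measures [A |-> #|A| / m k] on ['Z_(m k)]; among
   probability measures this determines [mu], and such a [mu] exists
   (product_of_uniforms_exists). *)
Definition product_of_uniforms (R : realType) (m : nat -> nat)
    (mu : set (Gm m) -> \bar R) : Prop :=
  forall (n : nat) (A : forall k, {set 'Z_(m k)}),
    mu [set x | forall k, (k < n)%N -> x k \in A k] =
    (\prod_(k < n) (#|A k|%:R / (m k)%:R))%:E.

Definition vM (m : nat -> nat) (n : nat) : nat := (\prod_(k < n) m k)%N.

(* The digits [n_k] of [n] in the mixed-radix system [vM m]; see [vdigit_sum]. *)
Definition vdigit (m : nat -> nat) (n k : nat) : nat := ((n %/ vM m k) %% m k)%N.

Lemma vM_gt0 (m : nat -> nat) (m_ge2 : forall k, (2 <= m k)%N) n :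
  (0 < vM m n)%N.
Proof. by rewrite /vM prodn_gt0// => i; apply: leq_trans (m_ge2 i). Qed.

Lemma ltn_vM (m : nat -> nat) (m_ge2 : forall k, (2 <= m k)%N) n :
  (n < vM m n)%N.
Proof.
elim: n => [|n ih]; first by rewrite /vM big_ord0.
rewrite /vM big_ord_recr /= -/(vM m n); apply: (leq_ltn_trans ih).
by rewrite ltn_Pmulr// (leq_ltn_trans _ ih).
Qed.

Lemma vdigit_eq0 (m : nat -> nat) (m_ge2 : forall k, (2 <= m k)%N) n k :
  (n <= k)%N -> vdigit m n k = 0%N.
Proof.
move=> nk; rewrite /vdigit divn_small ?mod0n// (leq_ltn_trans nk)//.
exact: ltn_vM.
Qed.

Lemma vdigit_sum (m : nat -> nat) (m_ge2 : forall k, (2 <= m k)%N) n :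
  n = (\sum_(k < n) vdigit m n k * vM m k)%N.
Proof.
have H K : n = (\sum_(k < K) vdigit m n k * vM m k + (n %/ vM m K) * vM m K)%N.
  elim: K => [|K ih]; first by rewrite big_ord0 /vM big_ord0 divn1 muln1.
  rewrite big_ord_recr /= {1}ih -addnA; congr (_ + _)%N.
  rewrite {4 5}/vM big_ord_recr /= -/(vM m K) divnMA.
  by rewrite {1}(divn_eq (n %/ vM m K) (m K)) mulnDl addnC -mulnA [(m K * _)%N]mulnC.
by rewrite [LHS](H n) divn_small ?ltn_vM// mul0n addn0.
Qed.

Section product_measure_exists.
Context (R : realType) (m : nat -> nat) (m_ge2 : forall k, (2 <= m k)%N).

Lemma measurable_vcyl n (x : vseq m) : measurable (vcyl n x : set (Gm m)).
Proof. by apply: sub_sigma_algebra; exists n => //; exists x. Qed.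

Lemma measurable_coord k (P : set 'Z_(m k)) :
  measurable [set x : Gm m | P (x k)].
Proof.
pose y (u : {ffun 'I_k.+1 -> nat}) : vseq m := fun i => inZp (u (inord i)).
have -> : [set x : Gm m | P (x k)] =
    \bigcup_u (if `[< P (y u k) >] then vcyl k.+1 (y u) : set (Gm m) else set0).
  apply/seteqP; split => [x /= Px|x [u _ /=]]; last first.
    by case: asboolP => // Pu; move->.
  pose u := [ffun i : 'I_k.+1 => (x i : nat)].
  have yu i : (i < k.+1)%N -> x i = y u i.
    by move=> ik; rewrite /y ffunE inordK// valZpK.
  by exists u => //=; rewrite asboolT -?yu.
apply: countable_bigcupT_measurable => // u.
by case: ifP => // _; exact: measurable_vcyl.
Qed.

Let rect n (A : forall k, {set 'Z_(m k)}) : set (Gm m) :=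
  [set x | forall k, (k < n)%N -> x k \in A k].

Let measurable_rect n A : measurable (rect n A).
Proof.
have -> : rect n A = \bigcap_(k in `I_n) [set x : Gm m | x k \in A k].
  by apply/seteqP; split => x /= h k /h.
apply: fin_bigcap_measurable => [|k _]; first exact: finite_II.
exact: (measurable_coord (fun z => z \in A k)).
Qed.

Let vMS n : vM m n.+1 = (vM m n * m n)%N.
Proof. by rewrite /vM big_ord_recr. Qed.

Let N (t : R) k := Num.truncn (t * (vM m k)%:R).

Let phi (t : R) : Gm m := fun k => inZp (N t k.+1).

Let mphi : measurable_fun [set: measurableTypeR R] phi.
Proof.
apply: (@measurability _ _ (measurableTypeR R) (Gm m) setT phi (\bigcup_n @vcyls m n)) => // _ [_ [n _ [x _ <-]] <-].
rewrite setTI.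
have -> : phi @^-1` vcyl n x = \bigcap_(k in `I_n) [set t | phi t k = x k].
  by apply/seteqP; split => t /= h k /h.
apply: fin_bigcap_measurable => [|k _]; first exact: finite_II.
have -> : [set t | phi t k = x k] =
    \bigcup_i (if `[< inZp i = x k >] then [set t | N t k.+1 = i] else set0).
  apply/seteqP; split => [t /= ht|t [i _ /=]]; last first.
    by case: asboolP => // <- /= <-.
  by exists (N t k.+1) => //=; rewrite asboolT.
apply: bigcupT_measurable => i; case: ifP => // _.
have M0 : (0 : R) < (vM m k.+1)%:R by rewrite ltr0n vM_gt0.
case: i => [|i].
  have -> : [set t | N t k.+1 = 0%N] = [set` `]-oo, ((vM m k.+1)%:R^-1 : R)[].
    apply/seteqP; split => t /=; rewrite in_itv /= /N -div1r ltr_pdivlMr//.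
      by move=> /eqP; rewrite eqn0Ngt truncn_gt0 -ltNge.
    by move=> h; apply/eqP; rewrite eqn0Ngt truncn_gt0 -ltNge.
  exact: measurable_itv.
have -> : [set t | N t k.+1 = i.+1] =
   [set` `[((i.+1)%:R / (vM m k.+1)%:R : R), ((i.+2)%:R / (vM m k.+1)%:R : R)[].
  apply/seteqP; split => t /=;
    rewrite in_itv /= /N ler_pdivrMr// ltr_pdivlMr//; last exact: truncn_def.
  move=> h; have t0 : 0 <= t * (vM m k.+1)%:R.
    by apply: ltW; apply: lt_le_trans ltr01 _; rewrite -truncn_gt0 h.
  by rewrite -h; exact: truncn_itv.
exact: measurable_itv.
Qed.

Let NS t k : 0 <= t -> N t k = (N t k.+1 %/ m k)%N.
Proof.
move=> t0; rewrite /N vMS natrM mulrA.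
have a0 : 0 <= t * (vM m k)%:R by rewrite mulr_ge0.
have mk : (0 < m k)%N by apply: leq_trans (m_ge2 k).
have mk' : (0 : R) < (m k)%:R by rewrite ltr0n.
apply: truncn_def; rewrite -(ler_pM2r mk') -(ltr_pM2r mk').
set a := _ * (m k)%:R.
have am0 : 0 <= a by rewrite /a mulr_ge0.
rewrite -!natrM -truncn_ge_nat// -truncn_lt_nat//.
by rewrite leq_divM/= ltn_ceil.
Qed.

Let phi_vcyl n (x : vseq m) : exists2 j, (j < vM m n)%N &
  forall t, 0 <= t < 1 -> vcyl n x (phi t) <-> N t n = j.
Proof.
elim: n => [|n [j jM ih]].
  exists 0%N => [|t /andP[t0 t1]]; first by rewrite /vM big_ord0.
  split=> // _; apply/eqP; rewrite /N eqn0Ngt truncn_gt0 -ltNge /vM big_ord0 mulr1//.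
have mn : (0 < m n)%N by apply: leq_trans (m_ge2 n).
have xm : (x n < m n)%N by rewrite -{2}(Zp_cast (m_ge2 n)) ltn_ord.
exists (j * m n + x n)%N => [|t t01].
  rewrite vMS; apply: (@leq_trans (j.+1 * m n)%N); last by rewrite leq_mul2r jM orbT.
  by rewrite mulSn addnC ltn_add2r.
have [t0 _] := andP t01.
have vS : vcyl n.+1 x (phi t) <-> vcyl n x (phi t) /\ phi t n = x n.
  split=> [h|[h1 h2] k].
    by split=> [k kn|]; apply: h => //; rewrite ltnS ltnW.
  by rewrite ltnS leq_eqVlt => /orP[/eqP->//|/h1].
rewrite vS ih// (NS _ t0).
have phiE : phi t n = x n <-> (N t n.+1 %% m n)%N = x n.
  have pE : (phi t n : nat) = (N t n.+1 %% m n)%N.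
    by rewrite /phi /=; congr (_ %% _)%N; exact: Zp_cast.
  by rewrite -pE; split=> [->//|h]; exact/val_inj.
rewrite phiE; split=> [[h1 h2]|->].
  by rewrite (divn_eq (N t n.+1) (m n)) h1 h2.
by rewrite divnMDl// modnMDl divn_small// modn_small// addn0.
Qed.

Let D : set (measurableTypeR R) := [set` `[(0 : R), 1[].
Let mD : measurable D. Proof. exact: measurable_itv. Qed.

Let mu0 (A : set (Gm m)) : \bar R := lebesgue_measure (phi @^-1` A `&` D).

Let mu00 : mu0 set0 = 0%E.
Proof. by rewrite /mu0 preimage_set0 set0I measure0. Qed.
Let mu0_ge0 A : (0 <= mu0 A)%E. Proof. exact: measure_ge0. Qed.
Let mphiA A : measurable A -> measurable (phi @^-1` A).
Proof. by move=> mA; rewrite -[X in measurable X]setTI; exact: mphi. Qed.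
Let mu0_sigma : semi_sigma_additive mu0.
Proof.
move=> F mF tF mUF; rewrite /mu0 preimage_bigcup setI_bigcupl.
apply: measure_semi_sigma_additive => //.
- by move=> i; apply: measurableI => //; exact: mphiA.
- apply: trivIset_setIr; apply/trivIsetP => i j _ _ ij.
  by rewrite -preimage_setI ((trivIsetP.1 tF) i j)// preimage_set0.
- by apply: bigcupT_measurable => i; apply: measurableI => //; exact: mphiA.
Qed.
Let mu1 : {measure set (Gm m) -> \bar R} :=
  HB.pack mu0 (isMeasure.Build _ _ _ mu0 mu00 mu0_ge0 mu0_sigma).

Let mu0T : mu0 setT = 1%E.
Proof.
by rewrite /mu0 preimage_setT setTI lebesgue_measure_itv/= lte_fin ltr01 oppr0 adde0.
Qed.
Let mu2 : probability (Gm m) R :=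
  HB.pack (mu1 : set _ -> _) mu1 (Measure_isProbability.Build _ _ _ mu1 mu0T).

Let mu0_vcyl n x : mu0 (vcyl n x) = ((vM m n)%:R^-1)%:E.
Proof.
have [j jM hj] := phi_vcyl n x.
have M0 : (0 : R) < (vM m n)%:R by rewrite ltr0n vM_gt0.
have -> : mu0 (vcyl n x) =
  lebesgue_measure [set` `[(j%:R / (vM m n)%:R : R), (j.+1%:R / (vM m n)%:R)[].
  congr lebesgue_measure; apply/seteqP; split => t /=; rewrite in_itv/=.
    case=> + t01; have := t01; rewrite /D/= in_itv/= => t01'.
    move=> /(hj _ t01') h.
    rewrite ler_pdivrMr// ltr_pdivlMr// -h truncn_itv// mulr_ge0//.
    by case/andP: t01'.
  rewrite ler_pdivrMr// ltr_pdivlMr// => h.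
  have t01 : 0 <= t < 1.
    apply/andP; split.
      by rewrite -(pmulr_lge0 _ M0); case/andP: h => + _; apply: le_trans.
    rewrite -(ltr_pM2r M0) mul1r; case/andP: h => _ /lt_le_trans; apply.
    by rewrite ler_nat.
  by split; [apply/(hj _ t01); exact: truncn_def|rewrite /D /= in_itv].
rewrite lebesgue_measure_itv/= lte_fin ltr_pM2r ?invr_gt0// ltr_nat ltnSn.
by rewrite -EFinB -mulrBl -natrB// subSnn mul1r.
Qed.

(* [mu] is the law of the mixed-radix digits of a uniform point of [0, 1[. *)
Lemma product_of_uniforms_exists :
  exists mu : probability (Gm m) R, product_of_uniforms mu.
Proof.
exists mu2 => n; rewrite /mu2 /=.
suff H d : forall A : (forall k, {set 'Z_(m k)}),
  (forall k, (d <= k < n)%N -> exists c, A k = [set c]%SET) ->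
  mu0 (rect n A) = (\prod_(k < n) (#|A k|%:R / (m k)%:R))%:E.
  by move=> A; apply: (H n) => k /andP[/leq_ltn_trans h /h]; rewrite ltnn.
elim: d => [|d ih] A hA.
  pose c k : 'Z_(m k) := odflt 0 [pick c in A k].
  have cE k : (k < n)%N -> A k = [set c k]%SET.
    move=> kn; have [//|e Ak] := hA k; rewrite /c.
    case: pickP => [e'|/(_ e)]; rewrite Ak inE ?eqxx//.
    by move=> /eqP->.
  have -> : rect n A = vcyl n c.
    apply/seteqP; split => x /= h k kn.
      by have := h k kn; rewrite cE// inE => /eqP.
    by rewrite cE// inE h.
  rewrite mu0_vcyl /vM natr_prod -prodfV; congr EFin.
  by apply: eq_bigr => k _; rewrite cE// cards1 mul1r.
have [nd|dn] := leqP n d.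
  by apply: ih => k /andP[dk kn]; have := leq_ltn_trans dk kn; rewrite ltnNge nd.
pose B j := eqtype.dfwith A (i := d) [set j]%SET.
have Bd j : B j d = [set j]%SET by exact: dfwith_in.
have Bk j k : k != d -> B j k = A k.
  by move=> kd; apply: dfwith_out; rewrite eq_sym.
have -> : rect n A = \big[setU/set0]_(j in A d) rect n (B j).
  rewrite -bigcup_pred; apply/seteqP; split => [x h|x [j /= jA h] k kn].
    exists (x d); first exact: (h d dn).
    move=> k kn; have [->|kd] := eqVneq k d; first by rewrite Bd inE.
    by rewrite Bk// h.
  have := h k kn; have [->|kd] := eqVneq k d; last by rewrite Bk.
  by rewrite Bd inE => /eqP->.
transitivity (\sum_(j in A d) mu0 (rect n (B j)))%E.
  apply: (measure_bigsetU_ord_cond mu1) => // i j _ _.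
  by move=> [x [/(_ d dn) + /(_ d dn)]]; rewrite !Bd !inE => /eqP<- /eqP<-.
pose rest := \prod_(k < n | k != Ordinal dn) (#|A k|%:R / (m k)%:R) : R.
under eq_bigr => j jA.
  rewrite ih; last first.
    move=> k /andP[dk kn]; have [->|kd] := eqVneq k d.
      by exists j; rewrite Bd.
    by rewrite Bk//; apply: hA; rewrite kn andbT ltn_neqAle eq_sym kd dk.
  rewrite (bigD1 (Ordinal dn))//= Bd cards1.
  rewrite (eq_bigr (fun k : 'I_n => #|A k|%:R / (m k)%:R)) -/rest; last first.
    by move=> k kd; rewrite Bk.
  over.
rewrite sumEFin sumr_const (bigD1 (Ordinal dn))//= -/rest.
by rewrite -mulrnAl -mulrnAl -[in LHS]natr1E.
Qed.
End product_measure_exists.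

Section fourier.
Context (R : realType) (m : nat -> nat).
Implicit Types (mu : {measure set (Gm m) -> \bar R}) (f : nat -> Gm m -> R[i]).

(* The norm of [R[i]] takes its values in [R[i]]. *)
Definition cmod (z : R[i]) : R := complex.Re `|z|.

Definition rademacher (k : nat) (x : Gm m) : R[i] :=
  let t := 2 * pi * (x k : nat)%:R / (m k)%:R in
  (cos t +i* sin t)%C.

(* The factors of index [k >= n] are all 1, by [vdigit_eq0]. *)
Definition vilenkin (n : nat) (x : Gm m) : R[i] :=
  \prod_(k < n) rademacher k x ^+ vdigit m n k.

Definition cintegral mu (A : set (Gm m)) (g : Gm m -> R[i]) : R[i] :=
  (Rintegral mu A (fun x => complex.Re (g x)) +i*
   Rintegral mu A (fun x => complex.Im (g x)))%C.

Definition cintegrable mu (g : Gm m -> R[i]) : Prop :=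
  mu.-integrable [set: Gm m] (fun x => (complex.Re (g x))%:E) /\
  mu.-integrable [set: Gm m] (fun x => (complex.Im (g x))%:E).

Definition Fn_measurable (n : nat) (g : Gm m -> R[i]) : Prop :=
  measurable_fun [set: g_sigma_algebraType (@vcyls m n)]
    (fun x => complex.Re (g x)) /\
  measurable_fun [set: g_sigma_algebraType (@vcyls m n)]
    (fun x => complex.Im (g x)).

(* The last clause says that [f n] is the conditional expectation of [f k]
   given F_n. *)
Definition martingale mu f : Prop :=
  [/\ forall n, Fn_measurable n (f n),
      forall n, cintegrable mu (f n) &
      forall n k (A : set (Gm m)), (n <= k)%N -> <<s @vcyls m n >> A ->
        cintegral mu A (f k) = cintegral mu A (f n)].

Definition maximal f (x : Gm m) : \bar R :=
  ereal_sup (range (fun n => (cmod (f n x))%:E)).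

Definition Hnorm mu (p : R) f : \bar R := Lnorm mu p%:E (maximal f).

Definition Hardy mu (p : R) f : Prop :=
  martingale mu f /\ (Hnorm mu p f < +oo)%E.

Definition weakLnorm mu (p : R) (g : Gm m -> \bar R) : \bar R :=
  poweR (ereal_sup [set (powR lam p)%:E * mu [set x | lam%:E < `|g x|] |
                    lam in [set l : R | 0 < l]%R])%E p^-1.

(* [R[i]^o] carries the topology of the norm of [R[i]]; the sequence is
   eventually constant when [f] is a martingale. *)
Definition fourier mu f (i : nat) : R[i] :=
  lim ((fun k => cintegral mu setT (fun x => f k x * (vilenkin i x)^*%C) : R[i]^o)
       @ \oo).

Definition partial_sum mu f (n : nat) (x : Gm m) : R[i] :=
  \sum_(0 <= k < n) fourier mu f k * vilenkin k x.

Definition Qsum (q : nat -> R) (n : nat) : R := \sum_(0 <= k < n) q k.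

Definition Tmean mu (q : nat -> R) f (n : nat) (x : Gm m) : R[i] :=
  ((Qsum q n)^-1)%:C%C * \sum_(0 <= k < n) (q k)%:C%C * partial_sum mu f k x.

Definition Tmax mu (q : nat -> R) f (x : Gm m) : \bar R :=
  ereal_sup [set (cmod (Tmean mu q f n x))%:E | n in [set n | (0 < n)%N]].

End fourier.

(* Main.v *)
Require Import Defs.
From mathcomp Require Import all_boot all_order all_algebra.
From mathcomp Require Import all_classical all_reals all_analysis.
From mathcomp Require Import measurable_realfun.
From mathcomp Require Import complex.
From mathcomp Require Import ring lra zify.

(** The weak-type inequality. Abel summation ([abel_le]) bounds [T_n f] by the
    Fejer means of orders at most [n], because [q] is non-decreasing and
    [q (n - 1) / Q n] is of order [1 / n]. It is therefore enough to bound the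
    maximal Fejer operator from [H_(1/2)] to weak [L_(1/2)].

    For orders at most [M L], everything takes place on the finitely many
    cylinders of rank [L], where integrals are averages over coordinates and the
    kernels are explicit. The self-similarity of the Vilenkin functions bounds the
    Fejer kernel ([cmod_fejer]) by a combination of the indicator functions of
    the sets where [x] and [t] agree before [A], except perhaps at one coordinate
    [s], with weights [M A * M s]. Applied to a function of modulus at most [c],
    carried by a cylinder of rank [N] and of mean 0 there, the maximal Fejer
    operator is thus at most of order [c * M A * M s / M N ^ 2] on sets of measure
    of order [1 / M A], for [s <= A <= N] ([fejer_atom_le]). The square roots of
    these bounds have integrals that are too large by a factor [N], but the
    bounds truncated at a height [lam] have integrals that add up to the order of
    [sqrt (c * lam) / M N], because they decay geometrically in [A - s]
    ([lacunary_min2], [atom_majorant_weak]).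

    Truncated functions can be added up although weak [L_(1/2)] has no norm. The
    martingale is cut at the thresholds [eps * 4 ^ k] by stopping times that are
    predictable, which is possible because [m] is bounded: the pieces are atoms as
    above, and the measure of their supports is controlled by the maximal function
    ([mean_stop_at_le]). Adding up the atoms gives [fejer_weak], and letting [L]
    tend to infinity gives [weak_type].

    The counterexample. For [p < 1/2], the martingale with increments
    [g ^ k * M k ^ 2 * r_k] on the cylinder of rank [k] around 0 belongs to [H_p]
    if [g > 1] is close enough to 1 ([bad_Hardy]), and its Fourier coefficient of
    index [M N] is [g ^ N * M N]. If the means were bounded in weak [L_p], the
    three means of orders [M N], [M N + 1], [M N + 2] would be bounded at a common
    point, uniformly in [N]; since [Q n <= n * q (n - 1)], the partial sums of
    orders [M N] and [M N + 1], and hence that coefficient, would be of order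
    [M N], which is absurd ([bad_unbounded]). *)

Set Implicit Arguments.
Unset Strict Implicit.
Unset Printing Implicit Defensive.
Import Order.TTheory GRing.Theory Num.Theory.
Import numFieldNormedType.Exports.
Local Open Scope classical_set_scope.
Local Open Scope ring_scope.

(** * Averages over coordinates *)

Section averages.
Context (m : nat -> nat) (m_ge2 : forall k, (2 <= m k)%N).
Implicit Types (k n l : nat) (x y : vseq m).

Definition agree n x y : Prop := forall k, (k < n)%N -> x k = y k.

Definition upd x k (d : 'Z_(m k)) : vseq m := eqtype.dfwith x d.

Lemma updE x k d : upd x (k := k) d k = d.
Proof. exact: dfwith_in. Qed.

Lemma updN x k d j : k != j -> upd x (k := k) d j = x j.
Proof. by move=> kj; rewrite /upd dfwith_out. Qed.

Lemma upd_id x k : upd x (x k) = x.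
Proof.
apply: functional_extensionality_dep => j.
by have [<-|kj] := eqVneq k j; [rewrite updE | rewrite updN].
Qed.

Lemma agree_updS n x y (d : 'Z_(m n)) :
  agree n x y -> agree n.+1 (upd x d) (upd y d).
Proof.
move=> xy j; rewrite ltnS => jn; have [<-|kj] := eqVneq n j; first by rewrite !updE.
by rewrite !updN// xy// ltn_neqAle eq_sym kj.
Qed.

Lemma agree_upd_out n x k (d : 'Z_(m k)) : (n <= k)%N -> agree n (upd x d) x.
Proof. by move=> nk j jn; rewrite updN// gtn_eqF// (leq_trans jn). Qed.

Lemma agreeS n x y : agree n.+1 x y <-> agree n x y /\ x n = y n.
Proof.
split=> [xy|[xy e] j]; first by split=> [j jn|]; apply: xy => //; rewrite ltnS ltnW.
by rewrite ltnS leq_eqVlt => /orP[/eqP->//|/xy].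
Qed.

Lemma agreeW n l x y : (n <= l)%N -> agree l x y -> agree n x y.
Proof. by move=> nl xy j jn; apply: xy; exact: leq_trans nl. Qed.

(** Measurability for the sigma-algebra generated by the cylinders of rank [n]. *)
Definition level T n (g : vseq m -> T) : Prop :=
  forall x y, agree n x y -> g x = g y.

Lemma levelW T n l (g : vseq m -> T) : (n <= l)%N -> level n g -> level l g.
Proof. by move=> nl gn x y xy; apply/gn/(agreeW nl). Qed.

Lemma card_Zm k : #|'Z_(m k)| = m k.
Proof. by rewrite card_ord Zp_cast. Qed.

Lemma mk_gt0 k : (0 < m k)%N. Proof. exact: leq_trans (m_ge2 k). Qed.

Lemma vMS n : vM m n.+1 = (vM m n * m n)%N.
Proof. by rewrite /vM big_ord_recr. Qed.

Lemma vM0 : vM m 0 = 1%N. Proof. by rewrite /vM big_ord0. Qed.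

Lemma leq_vM n l : (n <= l)%N -> (vM m n <= vM m l)%N.
Proof.
move=> /subnK<-; elim: (l - n)%N => // i ih; apply: (leq_trans ih).
by rewrite addSn vMS leq_pmulr// mk_gt0.
Qed.

Section field.
Context (F : numFieldType).
Implicit Types (g h : vseq m -> F) (s : seq nat).

Lemma mkF_neq0 k : (m k)%:R != 0 :> F.
Proof. by rewrite pnatr_eq0 -lt0n mk_gt0. Qed.

Lemma vM_neq0 n : (vM m n)%:R != 0 :> F.
Proof. by rewrite pnatr_eq0 -lt0n vM_gt0. Qed.

Definition coordavg k g : vseq m -> F :=
  fun x => (m k)%:R^-1 * \sum_(d : 'Z_(m k)) g (upd x d).

(** Averaging over the coordinates that are at least [n] is the conditional
    expectation given the first [n] coordinates; [avg (iota n l)] is this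
    expectation for functions of level [n + l]. *)
Definition avg s g : vseq m -> F := foldr coordavg g s.

Lemma avg_cons k s g : avg (k :: s) g = coordavg k (avg s g).
Proof. by []. Qed.

Lemma avg_cat s t g : avg (s ++ t) g = avg s (avg t g).
Proof. exact: foldr_cat. Qed.

Lemma coordavg_ext k g h : g =1 h -> coordavg k g =1 coordavg k h.
Proof. by move=> gh x; congr (_ * _); apply: eq_bigr. Qed.

Lemma avg_ext s g h : g =1 h -> avg s g =1 avg s h.
Proof. by move=> gh; elim: s => //= k s ih; apply: coordavg_ext. Qed.

Lemma coordavg_cst k g x : (forall d, g (upd x (k := k) d) = g x) ->
  coordavg k g x = g x.
Proof.
move=> gx; rewrite /coordavg (eq_bigr (fun=> g x))// sumr_const card_Zm.
by rewrite -[X in _ * X]mulr_natl mulKf// mkF_neq0.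
Qed.

Lemma coordavgMl k g h x : (forall d, h (upd x (k := k) d) = h x) ->
  coordavg k (fun y => h y * g y) x = h x * coordavg k g x.
Proof.
move=> hx; rewrite /coordavg (eq_bigr (fun d => h x * g (upd x d))).
  by rewrite -mulr_sumr mulrCA.
by move=> d _; rewrite hx.
Qed.

Lemma level_coordavgS n g : level n.+1 g -> level n (coordavg n g).
Proof.
by move=> gn x y xy; congr (_ * _); apply: eq_bigr => d _; exact/gn/agree_updS.
Qed.

Lemma level_avg_iota n l g : level (n + l) g -> level n (avg (iota n l) g).
Proof.
elim: l n => [|l ih] n gn /=; first by rewrite addn0 in gn.
by apply: level_coordavgS; apply: ih; rewrite addSnnS.
Qed.

Lemma coordavg_sum (I : Type) (r : seq I) (P : pred I) k (g : I -> vseq m -> F) x :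
  coordavg k (fun y => \sum_(i <- r | P i) g i y) x =
  \sum_(i <- r | P i) coordavg k (g i) x.
Proof. by rewrite /coordavg exchange_big/= mulr_sumr. Qed.

Lemma avg_sum (I : Type) (r : seq I) (P : pred I) s (g : I -> vseq m -> F) x :
  avg s (fun y => \sum_(i <- r | P i) g i y) x =
  \sum_(i <- r | P i) avg s (g i) x.
Proof.
elim: s x => //= k s ih x.
by rewrite -coordavg_sum; apply: coordavg_ext => y; rewrite ih.
Qed.

Lemma avgZ s c g x : avg s (fun y => c * g y) x = c * avg s g x.
Proof.
elim: s x => //= k s ih x.
by rewrite -(@coordavgMl k _ (fun=> c))//; apply: coordavg_ext.
Qed.

Lemma avgD s g h x : avg s (fun y => g y + h y) x = avg s g x + avg s h x.
Proof.
elim: s x => //= k s ih x; rewrite /coordavg -mulrDr -big_split/=.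
by congr (_ * _); apply: eq_bigr => d _; rewrite ih.
Qed.

Lemma avg_iotaMl N n l g h x : (N <= n)%N -> level N h ->
  avg (iota n l) (fun y => h y * g y) x = h x * avg (iota n l) g x.
Proof.
move=> Nn hN; elim: l n Nn x => //= l ih n Nn x.
rewrite -coordavgMl => [|d]; last by apply/hN/agree_upd_out.
by apply: coordavg_ext => y; rewrite ih// ltnW.
Qed.

Lemma avg_iota_level N n l g x : (N <= n)%N -> level N g ->
  avg (iota n l) g x = g x.
Proof.
move=> Nn gN; rewrite -[RHS]mulr1; transitivity (avg (iota n l) (fun y => g y * 1) x).
  by apply: avg_ext => y; rewrite mulr1.
rewrite (avg_iotaMl _ _ _ Nn)//; congr (_ * _).
elim: l n {Nn} x => //= l ih n x; rewrite (@coordavg_ext n _ (fun=> 1))//.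
by rewrite (@coordavg_cst n (fun=> 1)).
Qed.

Lemma avg_iota0 N L g x : (N <= L)%N ->
  avg (iota 0 L) g x = avg (iota 0 N) (avg (iota N (L - N)) g) x.
Proof. by move=> NL; rewrite -avg_cat -iotaD subnKC. Qed.

Lemma avg_widen N L g x : (N <= L)%N -> level N g ->
  avg (iota 0 L) g x = avg (iota 0 N) g x.
Proof.
move=> NL gN; rewrite (avg_iota0 _ _ NL); apply: avg_ext => y.
exact: avg_iota_level gN.
Qed.

Lemma avg_exchange s t (g : vseq m -> vseq m -> F) x y :
  avg s (fun u => avg t (g u) y) x = avg t (fun v => avg s (g^~ v) x) y.
Proof.
elim: s x => //= k s ih x; rewrite [RHS](@avg_ext t _ (fun v =>
  (m k)%:R^-1 * \sum_d avg s (g^~ v) (upd x (k := k) d)))//.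
by rewrite avgZ avg_sum; congr (_ * _); apply: eq_bigr => d _; rewrite ih.
Qed.

Lemma coordavg_le k g h x : (forall y, g y <= h y) -> coordavg k g x <= coordavg k h x.
Proof.
by move=> gh; rewrite /coordavg ler_wpM2l ?invr_ge0// ler_sum.
Qed.

Lemma avg_le s g h x : (forall y, g y <= h y) -> avg s g x <= avg s h x.
Proof. by move=> gh; elim: s x => //= k s ih x; apply: coordavg_le. Qed.

Lemma avg0 s x : avg s (fun=> 0) x = 0 :> F.
Proof.
rewrite -[RHS](mul0r (avg s (fun=> 0) x)) -avgZ; apply: avg_ext => y.
by rewrite mul0r.
Qed.

Lemma avg_ge0 s g x : (forall y, 0 <= g y) -> 0 <= avg s g x.
Proof. by move=> g0; rewrite -(avg0 s x) avg_le. Qed.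

End field.
End averages.

(** * Truncated sums *)

Section truncated.
Context (R : realType).
Implicit Types (a : nat -> R) (w : R).

Lemma minD_le (a b c : R) : 0 <= a -> 0 <= b -> 0 <= c ->
  Num.min (a + b) c <= Num.min a c + Num.min b c.
Proof. by move=> a0 b0 c0; rewrite !minEle; repeat case: ifP; lra. Qed.

Lemma min_sum_le (I : Type) (r : seq I) (P : pred I) (g : I -> R) (c : R) :
  (forall i, 0 <= g i) -> 0 <= c ->
  Num.min (\sum_(i <- r | P i) g i) c <= \sum_(i <- r | P i) Num.min (g i) c.
Proof.
move=> g0 c0; elim: r => [|i r ih]; first by rewrite !big_nil minEle c0.
rewrite !big_cons; case: ifP => // _; apply: le_trans (minD_le _ _ _) _ => //.
  exact: sumr_ge0.
by rewrite lerD2l.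
Qed.

Lemma minMl (c a b : R) : 0 <= c -> Num.min (c * a) (c * b) = c * Num.min a b.
Proof. by move=> c0; rewrite minr_pMr. Qed.

(** The induction removes the first term of the sequence, and the sum behaves
    differently before the sequence passes [w], where [a s] is the smaller
    term, and after, where [w ^+ 2 / a s] is: both bounds are needed at once. *)
Lemma lacunary_min_aux a w n : 0 < w -> (forall s, 0 < a s) ->
  (forall s, 2 * a s <= a s.+1) ->
  (a 0%N <= w -> \sum_(s < n) Num.min (a s) (w ^+ 2 / a s) <= 4 * w - a 0%N) /\
  (w < a 0%N -> \sum_(s < n) Num.min (a s) (w ^+ 2 / a s) <= 2 * w ^+ 2 / a 0%N).
Proof.
move=> w0; elim: n a => [|n ih] a a0 a2.
  rewrite big_ord0; split=> aw; first by lra.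
  by rewrite divr_ge0// ?mulr_ge0// ltW// exprn_gt0.
have [ihl ihg] := ih (fun s => a s.+1) (fun s => a0 s.+1) (fun s => a2 s.+1).
have a01 := a0 0%N; have a11 := a0 1%N; have a21 := a2 0%N.
have w2 : 0 < w ^+ 2 by rewrite exprn_gt0.
rewrite big_ord_recl /=; split=> aw.
  have m1 : Num.min (a 0%N) (w ^+ 2 / a 0%N) <= a 0%N by rewrite ge_min lexx.
  have [a1w|wa1] := leP (a 1%N) w.
    by apply: le_trans (lerD m1 (ihl a1w)) _; lra.
  apply: le_trans (lerD m1 (ihg wa1)) _.
  suff : 2 * w ^+ 2 / a 1%N <= 2 * w by lra.
  by rewrite ler_pdivrMr// expr2 -mulrA ler_pM2l// ler_pM2l// ltW.
have m1 : Num.min (a 0%N) (w ^+ 2 / a 0%N) <= w ^+ 2 / a 0%N by rewrite ge_min lexx orbT.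
have wa1 : w < a 1%N by lra.
apply: le_trans (lerD m1 (ihg wa1)) _.
suff : 2 * w ^+ 2 / a 1%N <= w ^+ 2 / a 0%N by lra.
rewrite ler_pdivrMr// mulrAC ler_pdivlMr// [2 * _]mulrC -mulrA ler_pM2l//.
Qed.

Lemma lacunary_min a w n : 0 < w -> (forall s, 0 < a s) ->
  (forall s, 2 * a s <= a s.+1) ->
  \sum_(s < n) Num.min (a s) (w ^+ 2 / a s) <= 4 * w.
Proof.
move=> w0 a0 a2; have [hl hg] := lacunary_min_aux n w0 a0 a2.
have a01 := a0 0%N.
have [aw|wa] := leP (a 0%N) w; first by apply: le_trans (hl aw) _; lra.
apply: le_trans (hg wa) _; rewrite ler_pdivrMr//.
suff : w ^+ 2 <= w * a 0%N by nra.
by rewrite expr2 ler_pM2l// ltW.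
Qed.

Lemma geo_sum_le (z : R) n : 0 <= z -> z < 1 -> \sum_(d < n) z ^+ d <= (1 - z)^-1.
Proof.
move=> z0 z1; have h : 0 < 1 - z by rewrite subr_gt0.
rewrite -[leRHS]mul1r ler_pdivlMr// -opprB mulrN mulrC -subrX1 opprB.
by rewrite gerBl exprn_ge0.
Qed.

(** On the diagonal [A - s = d] one has [2 ^+ d * a s <= a A], so that the sum is
    at most that of [lacunary_min] with [w] divided by the square root of
    [2 ^+ d]; the bounds of the diagonals form a convergent geometric series.
    Bounding the rows instead of the diagonals would cost a factor [n]. *)
Lemma lacunary_min2 a w n : 0 < w -> (forall s, 0 < a s) ->
  (forall s, 2 * a s <= a s.+1) ->
  \sum_(A < n) \sum_(s < A.+1) Num.min (a s) (w ^+ 2 / a A) <= 16 * w.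
Proof.
move=> w0 a0 a2.
(* [3 / 4] is a rational upper bound of [1 / sqrt 2]. *)
pose G s d := Num.min (a s) (((3 / 4) ^+ d * w) ^+ 2 / a s).
have aD s d : 2 ^+ d * a s <= a (s + d)%N.
  elim: d => [|d ih]; first by rewrite expr0 mul1r addn0.
  by rewrite addnS exprS -mulrA; apply: le_trans (a2 _); rewrite ler_pM2l.
have z0 d : 0 < (3 / 4 : R) ^+ d by rewrite exprn_gt0// divr_gt0.
have FG s d : Num.min (a s) (w ^+ 2 / a (s + d)%N) <= G s d.
  rewrite /G le_min ge_min lexx/= ge_min; apply/orP; right.
  rewrite ler_pdivrMr// mulrAC ler_pdivlMr// exprMn [_ ^+ d ^+ 2]exprAC -[leRHS]mulrA.
  rewrite [leRHS]mulrCA ler_pM2l ?exprn_gt0//.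
  apply: (@le_trans _ _ (((3 / 4) ^+ 2) ^+ d * (2 ^+ d * a s))); last first.
    by rewrite ler_wpM2l// exprn_ge0// exprn_ge0.
  by rewrite mulrA -exprMn ler_peMl ?(ltW (a0 _))// exprn_ege1//; lra.
have G0 s d : 0 <= G s d.
  by rewrite /G le_min (ltW (a0 _))/= divr_ge0 ?exprn_ge0 ?(ltW (a0 _))// mulr_ge0 ?ltW.
rewrite -(big_mkord xpredT (fun A => \sum_(s < A.+1) Num.min (a s) (w ^+ 2 / a A))).
rewrite (eq_big_nat _ _ (F2 := fun A =>
  \sum_(0 <= s < n | (s <= A)%N) Num.min (a s) (w ^+ 2 / a A))); last first.
  by move=> A /andP[_ An]; rewrite -(big_mkord xpredT (fun s => Num.min (a s) (w ^+ 2 / a A))) (big_nat_widen _ _ n).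
rewrite (exchange_big_dep_nat xpredT)//=.
apply: (@le_trans _ _ (\sum_(0 <= s < n) \sum_(0 <= d < n) G s d)).
  apply: ler_sum => s _.
  rewrite -(@big_nat_widenl _ _ _ s 0 n xpredT)// -{1}[s]add0n big_addn.
  rewrite [leRHS](@big_cat_nat _ _ _ (n - s))//= ?leq_subr// -[leLHS]addr0.
  by rewrite lerD ?sumr_ge0// ler_sum// => d _; rewrite addnC.
rewrite exchange_big/= big_mkord.
apply: (@le_trans _ _ (\sum_(d < n) 4 * w * (3 / 4) ^+ d)).
  apply: ler_sum => d _; rewrite big_mkord.
  apply: le_trans (lacunary_min n _ a0 a2) _; first by rewrite mulr_gt0.
  by rewrite mulrA mulrAC.
rewrite -mulr_sumr (_ : 16 * w = 4 * w * 4); last by ring.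
rewrite ler_pM2l ?mulr_gt0//; have e : (1 - 3 / 4)^-1 = 4 :> R by field.
by apply: le_trans (geo_sum_le _ _ _) _; rewrite ?e; lra.
Qed.
End truncated.

(** * The modulus *)

Section modulus.
Context (R : realType).
Implicit Types (z w : R[i]).

Lemma cmodC z : (cmod z)%:C%C = `|z|.
Proof. by rewrite /cmod normc_def. Qed.

Lemma cmod_ge0 z : 0 <= cmod z.
Proof. by rewrite -ler0c cmodC. Qed.

Lemma cmodM z w : cmod (z * w) = cmod z * cmod w.
Proof. by apply: complexI; rewrite rmorphM !cmodC normrM. Qed.

Lemma cmodD z w : cmod (z + w) <= cmod z + cmod w.
Proof. by rewrite -lecR rmorphD !cmodC ler_normD. Qed.

Lemma cmodN z : cmod (- z) = cmod z.
Proof. by rewrite /cmod normrN. Qed.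

Lemma cmodB z w : cmod (z - w) <= cmod z + cmod w.
Proof. by rewrite -(cmodN w) cmodD. Qed.

Lemma cmod0 : cmod 0 = 0 :> R.
Proof. by rewrite /cmod normr0. Qed.

Lemma cmod1 : cmod 1 = 1 :> R.
Proof. by rewrite /cmod normr1. Qed.

Lemma cmod_real (x : R) : cmod x%:C%C = `|x|.
Proof. by rewrite /cmod normc_def /= expr0n addr0 sqrtr_sqr. Qed.

Lemma natrC n : n%:R = (n%:R : R)%:C%C :> R[i].
Proof. by rewrite rmorph_nat. Qed.

Lemma cmod_nat n : cmod n%:R = n%:R :> R.
Proof. by rewrite natrC cmod_real ger0_norm. Qed.

Lemma cmod_conj z : cmod z^*%C = cmod z.
Proof. by rewrite /cmod normcJ. Qed.

Lemma cmodX z n : cmod (z ^+ n) = cmod z ^+ n.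
Proof. by elim: n => [|n ih]; rewrite ?expr0 ?cmod1// !exprS cmodM ih. Qed.

Lemma cmod_sum (I : Type) (r : seq I) (P : pred I) (g : I -> R[i]) :
  cmod (\sum_(i <- r | P i) g i) <= \sum_(i <- r | P i) cmod (g i).
Proof.
apply: (big_ind2 (fun z x => cmod z <= x)) => //; first by rewrite cmod0.
by move=> z x w y zx wy; apply: le_trans (cmodD _ _) _; apply: lerD.
Qed.

Lemma Re_sum (I : Type) (r : seq I) (P : pred I) (g : I -> R[i]) :
  complex.Re (\sum_(i <- r | P i) g i) = \sum_(i <- r | P i) complex.Re (g i).
Proof. by apply: (big_ind2 (fun z x => complex.Re z = x)) => // -[? ?] ? [? ?] ? <- <-. Qed.

Lemma Im_sum (I : Type) (r : seq I) (P : pred I) (g : I -> R[i]) :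
  complex.Im (\sum_(i <- r | P i) g i) = \sum_(i <- r | P i) complex.Im (g i).
Proof. by apply: (big_ind2 (fun z x => complex.Im z = x)) => // -[? ?] ? [? ?] ? <- <-. Qed.

Lemma ReZ (c : R) z : complex.Re (c%:C%C * z) = c * complex.Re z.
Proof. by case: z => a b /=; rewrite mul0r subr0. Qed.

Lemma ImZ (c : R) z : complex.Im (c%:C%C * z) = c * complex.Im z.
Proof. by case: z => a b /=; rewrite mul0r addr0. Qed.

End modulus.

(** * Averages of real and complex functions *)

Section real_averages.
Context (R : realType) (m : nat -> nat) (m_ge2 : forall k, (2 <= m k)%N).
Implicit Types (x y t : vseq m).

Lemma Re_avg s (g : vseq m -> R[i]) x :
  complex.Re (avg s g x) = avg s (fun y => complex.Re (g y)) x.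
Proof.
elim: s x => //= k s ih x; rewrite /coordavg natrC -fmorphV ReZ Re_sum.
by congr (_ * _); apply: eq_bigr.
Qed.

Lemma Im_avg s (g : vseq m -> R[i]) x :
  complex.Im (avg s g x) = avg s (fun y => complex.Im (g y)) x.
Proof.
elim: s x => //= k s ih x; rewrite /coordavg natrC -fmorphV ImZ Im_sum.
by congr (_ * _); apply: eq_bigr.
Qed.

Lemma cmod_avg s (g : vseq m -> R[i]) x :
  cmod (avg s g x) <= avg s (fun y => cmod (g y)) x.
Proof.
elim: s x => //= k s ih x; rewrite /coordavg cmodM natrC -fmorphV cmod_real.
rewrite ger0_norm ?invr_ge0// ler_wpM2l ?invr_ge0//.
by apply: le_trans (cmod_sum _ _ _) _; apply: ler_sum.
Qed.

(** An average is a sum of terms [g y / \prod m k], and truncation is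
    subadditive on nonnegative terms. *)
Lemma min_avg_le s (g : vseq m -> R) (c : R) x : (forall y, 0 <= g y) -> 0 <= c ->
  Num.min (avg s g x) c <=
  (\prod_(k <- s) m k)%:R * avg s (fun y => Num.min (g y / (\prod_(k <- s) m k)%:R) c) x.
Proof.
move=> + c0; elim: s g x => [|k s ih] g x g0 /=.
  by rewrite big_nil mul1r divr1.
rewrite big_cons natrM /coordavg mulr_sumr.
have mk0 := mkF_neq0 m_ge2 R k.
apply: le_trans (min_sum_le _ _ _ c0) _.
  by move=> d; rewrite mulr_ge0 ?invr_ge0 ?avg_ge0.
rewrite mulrACA mulfV// mul1r mulr_sumr.
apply: ler_sum => d _; rewrite -avgZ; apply: le_trans (ih _ _ _) _.
  by move=> y; rewrite mulr_ge0 ?invr_ge0.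
by rewrite ler_wpM2l// avg_le// => y; rewrite invfM mulrA (mulrC (g y)).
Qed.

(** For [n = 0], these [t] form a union of [m s] cylinders of rank [l], if
    [s < l], and the cylinder of rank [l] around [x] otherwise: the Fejer
    kernels are concentrated on such sets. *)
Definition eq_except n l s x t : bool :=
  all (fun k => (k == s) || (x k == t k)) (iota n l).

Lemma eq_except_cat n l l' s x t :
  eq_except n (l + l') s x t = eq_except n l s x t && eq_except (n + l) l' s x t.
Proof. by rewrite /eq_except iotaD all_cat. Qed.

Lemma eq_exceptC n l s x t : eq_except n l s x t = eq_except n l s t x.
Proof. by apply: eq_all => k; rewrite eq_sym [x k == _]eq_sym. Qed.

Lemma eq_exceptW l l' s x t : (l <= l')%N -> eq_except 0 l' s x t -> eq_except 0 l s x t.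
Proof. by move=> /subnKC<-; rewrite eq_except_cat => /andP[]. Qed.

Lemma eq_except_agree n s x t : (n <= s)%N -> eq_except 0 n s x t <-> agree n x t.
Proof.
move=> ns; split=> [/allP h k kn|h].
  have := h k; rewrite mem_iota => /(_ kn).
  by rewrite ltn_eqF ?(leq_trans kn)//= => /eqP.
by apply/allP => k; rewrite mem_iota/= => kn; rewrite h// eqxx orbT.
Qed.

Lemma level_eq_except n l s x : level (n + l) (eq_except n l s x).
Proof.
move=> y z yz; apply: eq_in_all => k; rewrite mem_iota => /andP[_ kn].
by rewrite (yz _ kn).
Qed.

Lemma avg_eq_except n l s x t :
  avg (iota n l) (fun y => (eq_except n l s x y)%:R) t =
  \prod_(k <- iota n l) (if k == s then 1 else (m k)%:R^-1) :> R.
Proof.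
elim: l n t => [|l ih] n t; first by rewrite big_nil.
rewrite big_cons avg_cons.
pose c : R := \prod_(k <- iota n.+1 l) (if k == s then 1 else (m k)%:R^-1).
rewrite (@coordavg_ext _ _ _ _ (fun y : vseq m => c * ((n == s) || (x n == y n))%:R)).
  rewrite coordavgMl// mulrC; congr (_ * _); rewrite /coordavg.
  case: eqP => [_|_] /=.
    by rewrite sumr_const card_Zm// -[1 *+ _]/(_%:R) mulVf// mkF_neq0.
  rewrite (bigD1 (x n))//= updE eqxx big1 ?addr0 ?mulr1// => d dx.
  by rewrite updE eq_sym (negbTE dx).
move=> y; rewrite -[c]/(\prod_(k <- _) _) -(ih n.+1 y) mulrC.
rewrite -(@avg_iotaMl _ _ n.+1 n.+1 l _ (fun z => ((n == s) || (x n == z n))%:R))// => [|u v uv].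
  by apply: avg_ext => u; rewrite -mulnb natrM.
by rewrite uv.
Qed.

(* Compared with [vM m n / vM m (n + l)], the product lacks at most the factor
   of index [s]. *)
Lemma prod_eq_except_le B n l s : (forall k, (m k <= B)%N) ->
  \prod_(k <- iota n l) (if k == s then 1 else (m k)%:R^-1) * (vM m (n + l))%:R <=
  (if (n <= s < n + l)%N then B%:R else 1) * (vM m n)%:R :> R.
Proof.
move=> mB; elim: l => [|l ih].
  by rewrite big_nil addn0 mul1r ifF ?mul1r//; apply/negbTE; lia.
rewrite -addn1 iotaD big_cat/= big_seq1 addn1 addnS vMS natrM.
rewrite mulrACA; case: eqP => [nls|/eqP nls].
  have -> : (n <= s < (n + l).+1)%N by lia.
  move: ih; rewrite ifF; last by apply/negbTE; lia.
  rewrite !mul1r => ih; rewrite mulrC ler_pM ?ler_nat//.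
  by rewrite mulr_ge0// prodr_ge0// => k _; case: eqP.
rewrite mulVf ?mkF_neq0// mulr1; apply: le_trans ih _.
by case: ifP => nsl; case: ifP => // h; lia.
Qed.

Lemma avg_eq_except_le B n l s x t : (forall k, (m k <= B)%N) ->
  avg (iota n l) (fun y => (eq_except n l s x y)%:R) t <=
  B%:R * (vM m n)%:R / (vM m (n + l))%:R :> R.
Proof.
move=> mB; rewrite avg_eq_except ler_pdivlMr ?ltr0n ?vM_gt0//.
apply: le_trans (prod_eq_except_le _ _ _ mB) _; rewrite ler_wpM2r//.
by case: ifP => // _; rewrite ler1n (leq_trans _ (mB 0%N))// mk_gt0.
Qed.

End real_averages.

(** * The kernels of the Vilenkin system *)

Section roots_of_unity.
Context (R : realType).
Implicit Types (a b : R).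

Definition cis a : R[i] := (cos a +i* sin a)%C.

Lemma cisD a b : cis (a + b) = cis a * cis b.
Proof. by rewrite /cis cosD sinD; apply/eqP; rewrite eq_complex /= eqxx addrC/=. Qed.

Lemma cis0 : cis 0 = 1.
Proof. by rewrite /cis cos0 sin0. Qed.

Lemma cisX a n : cis a ^+ n = cis (a * n%:R).
Proof.
elim: n => [|n ih]; first by rewrite expr0 mulr0 cis0.
by rewrite exprS -natr1 mulrDr mulr1 addrC cisD ih.
Qed.

Lemma cmod_cis a : cmod (cis a) = 1.
Proof. by rewrite /cmod normc_def /= cos2Dsin2 sqrtr1. Qed.

Lemma cis_neq1 a : 0 < a < 2 * pi -> cis a != 1.
Proof.
move=> /andP[a0 a2]; apply/negP => /eqP[/eqP + _].
have -> : a = (a / 2) *+ 2 by rewrite mulr2n; field.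
rewrite cos_mulr2n eq_sym -subr_eq0.
have : 0 < sin (a / 2) by apply: sin_gt0_pi; apply/andP; split; lra.
have := cos2Dsin2 (a / 2); move: (cos _) (sin _) => c s h s0 /eqP.
rewrite -mulr_natr => e; have : 0 < s ^+ 2 by rewrite exprn_gt0.
lra.
Qed.

Lemma cmod1_conj (z : R[i]) : cmod z = 1 -> z * z^*%C = 1.
Proof. by move=> z1; rewrite -sqr_normc -cmodC z1 expr1n. Qed.

Lemma sum_root_of_unity (z : R[i]) n : z ^+ n = 1 -> z != 1 ->
  \sum_(i < n) z ^+ i = 0.
Proof.
move=> zn z1; have := subrX1 z n; rewrite zn subrr => /esym/eqP.
by rewrite mulf_eq0 subr_eq0 (negbTE z1) => /eqP.
Qed.

End roots_of_unity.

Section kernels.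
Context (R : realType) (m : nat -> nat) (m_ge2 : forall k, (2 <= m k)%N).
Implicit Types (x t : Gm m) (k A d n : nat).

Definition zeta k : R[i] := cis (2 * pi / (m k)%:R).

Lemma rademacherE k x : rademacher R k x = zeta k ^+ x k.
Proof.
rewrite /zeta cisX /rademacher -[LHS]/(cis _); congr cis.
by rewrite mulrAC.
Qed.

Lemma zeta_m k : zeta k ^+ m k = 1.
Proof.
rewrite /zeta cisX divfK ?mkF_neq0// /cis mulr_natl cos2pi sin2pi//.
Qed.

Lemma zetaX_neq1 k d : (0 < d < m k)%N -> zeta k ^+ d != 1.
Proof.
move=> /andP[d0 dm]; rewrite cisX; apply: cis_neq1.
have mk0 : 0 < (m k)%:R :> R by rewrite ltr0n mk_gt0.
have pi0 := pi_gt0 R;  apply/andP; split.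
  by rewrite mulr_gt0 ?divr_gt0 ?mulr_gt0// ltr0n.
by rewrite mulrAC ltr_pdivrMr// ltr_pM2l ?mulr_gt0// ltr_nat.
Qed.

Lemma cmod_rademacher k x : cmod (rademacher R k x) = 1.
Proof. by rewrite rademacherE cmodX cmod_cis expr1n. Qed.

Definition rho k x t : R[i] := rademacher R k x * (rademacher R k t)^*%C.

Lemma cmod_rho k x t : cmod (rho k x t) = 1.
Proof. by rewrite cmodM cmod_conj !cmod_rademacher mulr1. Qed.

Lemma rho_eq1 k x t : x k = t k -> rho k x t = 1.
Proof. by rewrite /rho !rademacherE => ->; rewrite cmod1_conj// cmodX cmod_cis expr1n. Qed.

Lemma zeta_inj k i j : (i < j < m k)%N -> zeta k ^+ j != zeta k ^+ i.
Proof.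
move=> /andP[ij jm]; rewrite -(subnKC (ltnW ij)) exprD -subr_eq0.
have zi : zeta k ^+ i != 0.
  apply/eqP => z0; have := cmodX (zeta k) i; rewrite z0 cmod0 cmod_cis expr1n.
  by move/esym/eqP; rewrite oner_eq0.
rewrite -{2}[zeta k ^+ i]mulr1 -mulrBr mulf_neq0// subr_eq0.
by rewrite zetaX_neq1// subn_gt0 ij (leq_ltn_trans (leq_subr _ _)).
Qed.

(** [zeta k] is a primitive root of unity of order [m k]. *)
Lemma rho_neq1 k x t : x k != t k -> rho k x t != 1.
Proof.
move=> xt; have ltm (y : Gm m) : (y k < m k)%N by rewrite -[ltnRHS](Zp_cast (m_ge2 k)) ltn_ord.
have {}xt : (x k : nat) != t k by [].
apply/negP => /eqP r1.
have : rademacher R k x = rademacher R k t.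
  have := congr1 (fun z => z * rademacher R k t) r1.
  by rewrite /rho mul1r -mulrA [_^*%C * _]mulrC cmod1_conj ?cmod_rademacher// mulr1.
rewrite !rademacherE => /eqP; apply/negP.
move: xt; rewrite neq_ltn => /orP[xt|tx]; last by rewrite zeta_inj// tx ltm.
by rewrite eq_sym zeta_inj// xt ltm.
Qed.

Lemma rho_m k x t : rho k x t ^+ m k = 1.
Proof.
rewrite /rho exprMn -rmorphXn !rademacherE -!exprM ![(_ * m k)%N]mulnC !exprM.
by rewrite !zeta_m !expr1n rmorph1 mulr1.
Qed.

Lemma sum_rho k x t :
  \sum_(i < m k) rho k x t ^+ i = if x k == t k then (m k)%:R else 0.
Proof.
case: eqP => [xt|/eqP xt]; last by apply: sum_root_of_unity; rewrite ?rho_m// rho_neq1.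
by under eq_bigr do rewrite rho_eq1// expr1n; rewrite sumr_const card_ord.
Qed.

Lemma sum_rademacher k x : \sum_(d : 'Z_(m k)) rademacher R k (upd x d) = 0.
Proof.
under eq_bigr do rewrite rademacherE updE.
rewrite -(big_mkord xpredT (fun i => zeta k ^+ i)) Zp_cast// big_mkord.
apply: sum_root_of_unity; first exact: zeta_m.
by rewrite -[zeta k]expr1 zetaX_neq1//= m_ge2.
Qed.

Lemma vdigit_small A i k : (A <= k)%N -> (i < vM m A)%N -> vdigit m i k = 0%N.
Proof.
move=> Ak iA; rewrite /vdigit divn_small ?mod0n//.
exact: leq_trans iA (leq_vM m_ge2 Ak).
Qed.

Lemma vilenkinE A i x : (i < vM m A)%N ->
  vilenkin R i x = \prod_(k < A) rademacher R k x ^+ vdigit m i k.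
Proof.
have wide A' j : (i < vM m A')%N ->
    \prod_(k < A') rademacher R k x ^+ vdigit m i k =
    \prod_(k < A' + j) rademacher R k x ^+ vdigit m i k.
  move=> iA; elim: j => [|j ->]; first by rewrite addn0.
  by rewrite addnS big_ord_recr/= (vdigit_small (leq_addr _ _) iA) expr0 mulr1.
by move=> iA; rewrite /vilenkin (wide _ A) ?ltn_vM// addnC -wide.
Qed.

Lemma level_vilenkin A i : (i < vM m A)%N -> level A (vilenkin R i : vseq m -> _).
Proof.
move=> iA x y xy; rewrite !(vilenkinE _ iA); apply: eq_bigr => k _.
by rewrite !rademacherE xy.
Qed.

Lemma cmod_vilenkin i x : cmod (vilenkin R i x) = 1.
Proof.
rewrite /vilenkin; apply: (big_ind (fun z => cmod z = 1)); first exact: cmod1.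
  by move=> z w z1 w1; rewrite cmodM z1 w1 mulr1.
by move=> k _; rewrite cmodX cmod_rademacher expr1n.
Qed.

(** The digits of [d * vM m A + i] are those of [i] followed by [d]; this
    self-similarity is the source of the recursions for the kernels. *)
Lemma vilenkinD A d i x : (d < m A)%N -> (i < vM m A)%N ->
  vilenkin R (d * vM m A + i) x = rademacher R A x ^+ d * vilenkin R i x.
Proof.
move=> dm iA; have lt : (d * vM m A + i < vM m A.+1)%N.
  rewrite vMS mulnC; apply: (@leq_trans (vM m A * d.+1)).
    by rewrite mulnS addnC ltn_add2r.
  by rewrite leq_mul2l dm orbT.
rewrite (vilenkinE _ lt) (vilenkinE _ iA) big_ord_recr/= mulrC; congr (_ * _).
  congr (_ ^+ _); rewrite /vdigit divnMDl ?vM_gt0// (divn_small iA) addn0.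
  exact: modn_small.
apply: eq_bigr => k _; congr (_ ^+ _).
have -> : vM m A = ((\prod_(k.+1 <= j < A) m j) * m k * vM m k)%N.
  rewrite /vM -!(big_mkord xpredT m) (@big_cat_nat _ _ _ k)//= ?(ltnW (ltn_ord k))//.
  by rewrite mulnC; congr muln; rewrite big_ltn// mulnC.
by rewrite /vdigit mulnA divnMDl ?vM_gt0// mulnA modnMDl.
Qed.

Definition dirichlet n x t : R[i] := \sum_(i < n) vilenkin R i x * (vilenkin R i t)^*%C.

(** The sum, and not the mean, of the first [n] Dirichlet kernels. *)
Definition fejer n x t : R[i] := \sum_(k < n) dirichlet k x t.

Lemma level_dirichlet n A x : (n <= vM m A)%N -> level A (dirichlet n x : vseq m -> _).
Proof.
move=> nA t u tu; apply: eq_bigr => i _.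
by rewrite (level_vilenkin (leq_trans (ltn_ord i) nA) tu).
Qed.

Lemma level_fejer n A x : (n <= vM m A)%N -> level A (fejer n x : vseq m -> _).
Proof.
move=> nA t u tu; apply: eq_bigr => i _.
by apply: level_dirichlet tu; rewrite (leq_trans _ nA)// ltnW.
Qed.

Lemma dirichletD A d n x t : (d < m A)%N -> (n <= vM m A)%N ->
  dirichlet (d * vM m A + n) x t =
  dirichlet (d * vM m A) x t + rho A x t ^+ d * dirichlet n x t.
Proof.
move=> dm nA; rewrite /dirichlet big_split_ord/=; congr (_ + _).
rewrite mulr_sumr; apply: eq_bigr => i _.
have iA : (i < vM m A)%N by apply: leq_trans nA.
by rewrite !vilenkinD// rmorphM rmorphXn mulrACA -exprMn.
Qed.

Lemma dirichletM A d x t : (d <= m A)%N ->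
  dirichlet (d * vM m A) x t = (\sum_(i < d) rho A x t ^+ i) * dirichlet (vM m A) x t.
Proof.
elim: d => [|d ih] dm; first by rewrite mul0n big_ord0 mul0r /dirichlet big_ord0.
by rewrite mulSn addnC dirichletD// ih 1?ltnW// big_ord_recr/= mulrDl.
Qed.

Lemma eq_exceptS A s x t :
  eq_except 0 A.+1 s x t = eq_except 0 A s x t && ((A == s) || (x A == t A)).
Proof. by rewrite -addn1 eq_except_cat /eq_except/= andbT. Qed.

Lemma dirichlet_vM A x t : dirichlet (vM m A) x t = (vM m A)%:R * (eq_except 0 A A x t)%:R.
Proof.
elim: A => [|A ih].
  by rewrite vM0 /dirichlet big_ord1 /vilenkin !big_ord0 rmorph1 !mul1r.
rewrite vMS mulnC dirichletM// ih sum_rho eq_exceptS (ltn_eqF (ltnSn A))/=.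
have -> : eq_except 0 A A.+1 x t = eq_except 0 A A x t.
  by apply/idP/idP; rewrite !eq_except_agree.
by case: eqP => _; rewrite ?andbT ?andbF ?mul0r ?mulr0// natrM mulrA.
Qed.

Lemma fejerD A d n x t : (d < m A)%N -> (n <= vM m A)%N ->
  fejer (d * vM m A + n) x t =
  fejer (d * vM m A) x t + n%:R * dirichlet (d * vM m A) x t
  + rho A x t ^+ d * fejer n x t.
Proof.
move=> dm nA; rewrite /fejer big_split_ord/= -addrA; congr (_ + _).
rewrite mulr_natl -[X in _ *+ X](card_ord n) -sumr_const [X in _ + X]mulr_sumr -big_split/=.
by apply: eq_bigr => k _; rewrite dirichletD// (leq_trans _ nA)// ltnW.
Qed.

Lemma fejerM A d x t : (d <= m A)%N ->
  fejer (d * vM m A) x t = (vM m A)%:R * \sum_(i < d) dirichlet (i * vM m A) x t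
    + (\sum_(i < d) rho A x t ^+ i) * fejer (vM m A) x t.
Proof.
elim: d => [|d ih] dm.
  by rewrite mul0n !big_ord0 mul0r mulr0 addr0 /fejer big_ord0.
rewrite mulSn addnC fejerD// ih 1?ltnW// !big_ord_recr/= mulrDr mulrDl.
by rewrite addrACA !addrA; congr (_ + _); rewrite -!addrA; congr (_ + _); rewrite addrC.
Qed.

(** ** Size of the kernels *)

Context (B : nat) (mB : forall k, (m k <= B)%N).

(** Up to a constant, the size of the Fejer kernel of order [vM m A], which is
    the mean of the first [vM m A] Dirichlet kernels. *)
Definition majorant A x t : R := \sum_(s < A.+1) (vM m s)%:R * (eq_except 0 A s x t)%:R.

Lemma majorant_ge0 A x t : 0 <= majorant A x t.
Proof. by apply: sumr_ge0 => s _; rewrite mulr_ge0. Qed.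

Lemma eq_except_majorant A x t : (vM m A)%:R * (eq_except 0 A A x t)%:R <= majorant A x t.
Proof.
by rewrite /majorant big_ord_recr/= lerDr sumr_ge0// => s _; rewrite mulr_ge0.
Qed.

Lemma cmod_sum_rhoX k d x t : cmod (\sum_(i < d) rho k x t ^+ i) <= d%:R.
Proof.
apply: le_trans (cmod_sum _ _ _) _; under eq_bigr do rewrite cmodX cmod_rho expr1n.
by rewrite sumr_const card_ord.
Qed.

Lemma cmod_dirichletM A d x t : (d <= m A)%N ->
  cmod (dirichlet (d * vM m A) x t) <= d%:R * ((vM m A)%:R * (eq_except 0 A A x t)%:R).
Proof.
move=> dm; rewrite dirichletM// dirichlet_vM cmodM ler_pM ?cmod_ge0 ?cmod_sum_rhoX//.
by rewrite cmodM !cmod_nat.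
Qed.

Lemma cmod_sum_dirichletM A d x t : (d <= m A)%N ->
  cmod (\sum_(i < d) dirichlet (i * vM m A) x t) <=
  d%:R * (B%:R * ((vM m A)%:R * (eq_except 0 A A x t)%:R)).
Proof.
move=> dm; apply: le_trans (cmod_sum _ _ _) _.
rewrite -[X in X%:R * _](card_ord d) mulr_natl -sumr_const; apply: ler_sum => i _.
have im : (i <= m A)%N by rewrite (leq_trans _ dm)// ltnW.
apply: le_trans (cmod_dirichletM _ _ im) _.
by rewrite ler_wpM2r ?mulr_ge0// ler_nat (leq_trans im).
Qed.

(** If [x] and [t] differ at the coordinate [A], the geometric sum in [fejerM]
    vanishes, and the other term is supported where [x] and [t] agree before
    [A]. If they agree at [A], the geometric sum is [m A] and both terms are
    absorbed by [majorant A.+1]. *)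
Lemma cmod_fejer_vM A x t :
  cmod (fejer (vM m A) x t) <= B%:R * ((vM m A)%:R * majorant A x t).
Proof.
elim: A => [|A ih].
  rewrite vM0 /fejer big_ord1 /dirichlet big_ord0 cmod0.
  by rewrite !mulr_ge0// majorant_ge0.
have -> : majorant A.+1 x t = (\sum_(s < A.+1) (vM m s)%:R * (eq_except 0 A.+1 s x t)%:R)
    + (vM m A.+1)%:R * (eq_except 0 A.+1 A.+1 x t)%:R.
  by rewrite /majorant big_ord_recr.
rewrite [X in fejer X](vMS m A) mulnC fejerM// sum_rho.
have hD := @cmod_sum_dirichletM A (m A) x t (leqnn _).
set D := \sum_(i < _) _ in hD *; set c := ((vM m A)%:R * _ : R) in hD.
have c0 : 0 <= c by rewrite mulr_ge0.
have hMD : cmod ((vM m A)%:R * D) <= B%:R * ((vM m A.+1)%:R * c).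
  rewrite cmodM cmod_nat vMS natrM; apply: le_trans (ler_wpM2l _ hD) _ => //.
  by rewrite le_eqVlt; apply/orP; left; apply/eqP; ring.
have cA : eq_except 0 A A.+1 x t = eq_except 0 A A x t.
  by apply/idP/idP; rewrite !eq_except_agree.
case: eqP => xt; last first.
  rewrite mul0r addr0; apply: le_trans hMD _.
  rewrite ler_wpM2l// ler_wpM2l// (bigD1 ord_max)//= -addrA.
  rewrite eq_exceptS eqxx orTb andbT lerDl addr_ge0//.
  by rewrite sumr_ge0// => s _; rewrite mulr_ge0.
apply: le_trans (cmodD _ _) _; rewrite [cmod (_%:R * fejer _ _ _)]cmodM cmod_nat.
rewrite addrC mulrDr mulrDr lerD//.
  apply: le_trans (ler_wpM2l _ ih) _; first exact: ler0n.
  rewrite vMS natrM mulrCA [_ * (m A)%:R]mulrC -mulrA ler_wpM2l// ler_wpM2l//.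
  rewrite ler_wpM2l//; apply: ler_sum => s _.
  by rewrite eq_exceptS xt eqxx orbT andbT.
apply: le_trans hMD _; rewrite ler_wpM2l// ler_wpM2l// eq_exceptS xt eqxx orbT andbT cA.
by rewrite /c ler_wpM2r// ler_nat leq_vM.
Qed.

(** The digits of [n] split the kernel by [fejerD] into pieces of ranks at most
    that of the leading digit, multiplied by unimodular factors. *)
Lemma cmod_fejer A n x t : (n < vM m A)%N ->
  cmod (fejer n x t) <= 3 * B%:R ^+ 2 * \sum_(a < A) (vM m a)%:R * majorant a x t.
Proof.
have B1 : 1 <= B%:R :> R by rewrite ler1n (leq_trans _ (mB 0%N))// mk_gt0.
elim: A n => [|A ih] n nA.
  have -> : n = 0%N by move: nA; rewrite vM0 ltnS leqn0 => /eqP.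
  by rewrite /fejer !big_ord0 cmod0 mulr0.
pose d := (n %/ vM m A)%N; pose n' := (n %% vM m A)%N.
have n'A : (n' < vM m A)%N by rewrite ltn_mod vM_gt0.
have dm : (d < m A)%N by rewrite ltn_divLR ?vM_gt0// mulnC -vMS.
have dB : (d <= B)%N by rewrite ltnW// (leq_trans dm).
rewrite (divn_eq n (vM m A)) -/d -/n' fejerD// ?(ltnW n'A)//.
rewrite big_ord_recr/= mulrDr addrC.
apply: le_trans (cmodD _ _) _; rewrite lerD//.
  by rewrite cmodM cmodX cmod_rho expr1n mul1r ih.
have := eq_except_majorant A x t; have := majorant_ge0 A x t.
set G := majorant _ _ _ => G0 cG.
have MA0 : 0 <= (vM m A)%:R :> R by [].
have dBR : d%:R <= B%:R :> R by rewrite ler_nat.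
have hD : cmod (dirichlet (d * vM m A) x t) <= B%:R * G.
  apply: le_trans (cmod_dirichletM _ _ (ltnW dm)) _.
  by rewrite ler_pM// mulr_ge0.
have hS : cmod (\sum_(i < d) dirichlet (i * vM m A) x t) <= B%:R * (B%:R * G).
  apply: le_trans (cmod_sum_dirichletM _ _ (ltnW dm)) _.
  by rewrite ler_pM ?mulr_ge0// ler_wpM2l.
have hF : cmod (fejer (d * vM m A) x t) <= 2 * B%:R ^+ 2 * ((vM m A)%:R * G).
  rewrite fejerM ?(ltnW dm)//; apply: le_trans (cmodD _ _) _.
  rewrite [X in X + _]cmodM cmod_nat [X in _ + X]cmodM.
  rewrite (_ : _ * (_ * G) = (vM m A)%:R * (B%:R * (B%:R * G))
    + B%:R * (B%:R * ((vM m A)%:R * G))); last by ring.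
  rewrite lerD// ?ler_wpM2l// ler_pM ?cmod_ge0//.
    exact: le_trans (cmod_sum_rhoX _ _ _ _) _.
  exact: cmod_fejer_vM.
apply: le_trans (cmodD _ _) _; rewrite cmodM cmod_nat.
apply: le_trans (lerD hF (ler_wpM2l (ler0n _ _) hD)) _.
rewrite (_ : 3 * _ * _ = 2 * B%:R ^+ 2 * ((vM m A)%:R * G) +
   (vM m A)%:R * (B%:R * (B%:R * G))); last by ring.
rewrite lerD2l ler_pM ?mulr_ge0 ?ler_nat ?(ltnW n'A)//.
by rewrite ler_wpM2l// ler_peMl.
Qed.

End kernels.

(** * Atoms *)

Section mean.
Context (m : nat -> nat) (m_ge2 : forall k, (2 <= m k)%N) (F : numFieldType).

(** The integral of a function of level [L]. *)
Definition mean L (g : vseq m -> F) : F := avg (iota 0 L) g (fun=> 0).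

Lemma avg_mean L g x : level L g -> avg (iota 0 L) g x = mean L g.
Proof. by move=> gL; apply: (@level_avg_iota _ _ 0 L). Qed.

Lemma mean_widen N L g : (N <= L)%N -> level N g -> mean L g = mean N g.
Proof. by move=> NL gN; rewrite /mean (avg_widen _ _ NL). Qed.

Lemma mean_ext L g h : g =1 h -> mean L g = mean L h.
Proof. by move=> gh; apply: avg_ext. Qed.

Lemma mean_le L (g h : vseq m -> F) : (forall y, g y <= h y) -> mean L g <= mean L h.
Proof. exact: avg_le. Qed.

Lemma mean_ge0 L (g : vseq m -> F) : (forall y, 0 <= g y) -> 0 <= mean L g.
Proof. exact: avg_ge0. Qed.

Lemma meanZ L c g : mean L (fun y => c * g y) = c * mean L g.
Proof. exact: avgZ. Qed.

Lemma meanD L (g h : vseq m -> F) : mean L (fun y => g y + h y) = mean L g + mean L h.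
Proof. exact: avgD. Qed.

Lemma mean_sum L (I : Type) (r : seq I) (P : pred I) (g : I -> vseq m -> F) :
  mean L (fun y => \sum_(i <- r | P i) g i y) = \sum_(i <- r | P i) mean L (g i).
Proof. exact: avg_sum. Qed.

Lemma mean_tower N L (g : vseq m -> F) : (N <= L)%N ->
  mean L g = mean N (avg (iota N (L - N)) g).
Proof. by move=> NL; rewrite /mean (avg_iota0 _ _ NL). Qed.

Lemma meanMl_tower N L (g h : vseq m -> F) : (N <= L)%N -> level N h ->
  mean L (fun y => h y * g y) = mean N (fun y => h y * avg (iota N (L - N)) g y).
Proof.
by move=> NL hN; rewrite (mean_tower _ NL); apply: avg_ext => y; rewrite (@avg_iotaMl _ _ N N).
Qed.

End mean.

Section atoms.
Context (R : realType) (m : nat -> nat) (m_ge2 : forall k, (2 <= m k)%N).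
Context (B : nat) (mB : forall k, (m k <= B)%N).
Implicit Types (x t : vseq m) (P : pred (vseq m)).

Let M n : R := (vM m n)%:R.
Let M_gt0 n : 0 < M n. Proof. by rewrite ltr0n vM_gt0. Qed.
Let M_le n l : (n <= l)%N -> M n <= M l. Proof. by move=> nl; rewrite ler_nat leq_vM. Qed.
Let M2 n : 2 * M n <= M n.+1.
Proof. by rewrite /M vMS natrM mulrC ler_wpM2l// ler_nat. Qed.
Let B1 : 1 <= B%:R :> R.
Proof. by rewrite ler1n (leq_trans _ (mB 0%N))// mk_gt0. Qed.

Lemma sum_vM T : \sum_(a < T.+1) (vM m a)%:R <= 2 * (vM m T)%:R :> R.
Proof.
elim: T => [|T ih]; first by rewrite big_ord1 vM0; lra.
by rewrite big_ord_recr/=; have := M2 T; rewrite /M; lra.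
Qed.

Lemma vM_bracket n : (0 < n)%N -> exists T, (vM m T <= n < vM m T.+1)%N.
Proof.
move=> n0; have ex : exists T, (vM m T <= n)%N by exists 0%N; rewrite vM0.
have ub T : (vM m T <= n)%N -> (T <= n)%N.
  by move=> Tn; apply: ltnW; apply: leq_trans (ltn_vM m_ge2 T) Tn.
case: (ex_maxnP ex ub) => T Tn Tmax; exists T; rewrite Tn/= ltnNge.
by apply/negP => /Tmax; rewrite ltnn.
Qed.

Lemma sum_ord_lt (g : nat -> R) n l : (n <= l)%N ->
  \sum_(a < l | (a < n)%N) g a = \sum_(a < n) g a.
Proof.
move=> nl; rewrite -(big_mkord (fun a => (a < n)%N) g) -(big_mkord xpredT g).
by rewrite [RHS](big_nat_widen _ _ l).
Qed.

(** The part of [P] on which the summand of index [s] of [majorant A x] lives. *)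
Definition slice P A s x t : R := (P t && eq_except 0 A s x t)%:R.

Let slice_ge0 P A s x t : 0 <= slice P A s x t. Proof. by []. Qed.

Lemma level_slice N P A s x L : level N P -> (N <= L)%N -> (A <= L)%N ->
  level L (slice P A s x).
Proof.
move=> PN NL AL t u tu; congr (nat_of_bool _)%:R; congr andb.
  by apply/PN/(agreeW NL).
by apply/(@level_eq_except m 0 A s x)/(agreeW AL).
Qed.

(** The integral of [majorant A x] over the set [P]. *)
Definition mass L P A x : R := \sum_(s < A.+1) M s * mean L (slice P A s x).

Lemma mass_ge0 L P A x : 0 <= mass L P A x.
Proof. by apply: sumr_ge0 => s _; rewrite mulr_ge0// mean_ge0. Qed.

(** A bound, up to a constant, for the maximal Fejer operator on a function that
    is at most [1] in modulus, vanishes outside the set [P] of level [N], and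
    has mean 0 on the cylinders of rank [N]; see [fejer_atom_le]. *)
Definition atom_majorant N P x : R := (M N)^-1 * \sum_(A < N.+1) M A * mass N P A x.

Lemma atom_majorant_ge0 N P x : 0 <= atom_majorant N P x.
Proof.
by rewrite mulr_ge0 ?invr_ge0// sumr_ge0// => A _; rewrite mulr_ge0// mass_ge0.
Qed.

Lemma level_mass L P A : level A (mass L P A).
Proof.
move=> x y xy; apply: eq_bigr => s _; congr (_ * _); apply: mean_ext => t.
by rewrite /slice ![eq_except _ _ _ _ t]eq_exceptC (@level_eq_except m 0 A s t _ _ xy).
Qed.

Lemma level_atom_majorant N P : level N (atom_majorant N P).
Proof.
move=> x y xy; congr (_ * _); apply: eq_bigr => A _; congr (_ * _).
by apply: level_mass; apply: agreeW xy; rewrite -ltnS.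
Qed.

Lemma mass_le_atom_majorant N P x : mass N P N x <= atom_majorant N P x.
Proof.
rewrite /atom_majorant big_ord_recr/= mulrDr mulKf ?gt_eqF// lerDr.
by rewrite mulr_ge0 ?invr_ge0// sumr_ge0// => A _; rewrite mulr_ge0// mass_ge0.
Qed.

Lemma mass_widen N L P A x : level N P -> (A <= N <= L)%N ->
  mass L P A x = mass N P A x.
Proof.
move=> PN /andP[AN NL]; apply: eq_bigr => s _; congr (_ * _).
exact: (mean_widen m_ge2 NL (level_slice _ _ PN (leqnn N) AN)).
Qed.

(** Beyond the level [N] of [P] the mass can only grow by a constant factor. For
    [s < N] the summands decrease with [A]. For [N <= s] they live in the
    cylinder of rank [N] around [x], of which they occupy a proportion of at most
    [B * M N / M A], while the weights [M s] sum to at most [2 * M A]. *)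
Lemma mass_le N L P A x : level N P -> (N <= A <= L)%N ->
  mass L P A x <= 3 * B%:R * mass L P N x.
Proof.
move=> PN /andP[NA AL]; have NL := leq_trans NA AL.
have inN s : (N <= s)%N -> slice P N s x =1 slice P N N x.
  move=> Ns t; congr (nat_of_bool (_ && _))%:R.
  by apply/idP/idP; rewrite !eq_except_agree.
have far s : (N <= s)%N -> mean L (slice P A s x) <=
    B%:R * M N / M A * mean L (slice P N N x).
  move=> Ns; pose g t : R := (eq_except N (A - N) s x t)%:R.
  have lg : level A g by rewrite -(subnKC NA) => t u tu; rewrite /g (@level_eq_except m N (A - N) s x _ _ tu).
  have le t : slice P A s x t = slice P N N x t * g t.
    by rewrite -(inN s)// /slice /g -natrM mulnb -andbA -eq_except_cat subnKC.
  rewrite (mean_ext _ le) (mean_widen m_ge2 AL); last first.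
    move=> t u tu; rewrite (lg _ _ tu); congr (_ * _).
    by apply: (level_slice _ _ PN NA NA).
  rewrite (@meanMl_tower _ _ N)//; last exact: level_slice PN _ _.
  rewrite (mean_widen m_ge2 NL); last exact: level_slice PN _ _.
  rewrite -meanZ; apply: mean_le => t; rewrite mulrC ler_wpM2r//.
  by have := @avg_eq_except_le R m m_ge2 B N (A - N) s x t mB; rewrite subnKC.
have near s : mean L (slice P A s x) <= mean L (slice P N s x).
  apply: mean_le => t; rewrite /slice ler_nat.
  by case: andP => // -[-> h]; rewrite (eq_exceptW NA h).
have I0 : 0 <= mean L (slice P N N x) by rewrite mean_ge0.
have IN : M N * mean L (slice P N N x) <= mass L P N x.
  by rewrite /mass big_ord_recr/= lerDr sumr_ge0// => s _; rewrite mulr_ge0// mean_ge0.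
rewrite {1}/mass (bigID (fun s : 'I_A.+1 => (s < N)%N))/=.
rewrite (_ : 3 * B%:R * _ = B%:R * mass L P N x + 2 * B%:R * mass L P N x); last by ring.
rewrite lerD//.
  apply: (@le_trans _ _ (mass L P N x)); last by rewrite ler_peMl ?mass_ge0.
  rewrite (sum_ord_lt (fun s => M s * mean L (slice P A s x)))//; last exact: ltnW.
  rewrite /mass big_ord_recr/= -[leLHS]addr0 lerD// ?mulr_ge0//.
  by apply: ler_sum => s _; rewrite ler_wpM2l// ltW.
apply: (@le_trans _ _ (\sum_(s < A.+1) M s * (B%:R * M N / M A * mean L (slice P N N x)))).
  rewrite big_mkcond; apply: ler_sum => s _; case: ifPn; rewrite -?leqNgt => h.
    by rewrite ler_wpM2l ?far// ltW.
  by rewrite !mulr_ge0// ?invr_ge0// ltW.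
rewrite -mulr_suml; apply: le_trans (ler_wpM2r _ (sum_vM A)) _.
  by rewrite !mulr_ge0// ?invr_ge0// ltW.
rewrite -/(M A) [leLHS](_ : _ = 2 * B%:R * (M N * mean L (slice P N N x))).
  by rewrite ler_wpM2l// mulr_ge0.
by have MA := M_gt0 A; field; rewrite gt_eqF.
Qed.

Definition atom_const : R := 21 * B%:R ^+ 3.

(** For [n <= M N] the kernel is constant on the cylinders of rank [N], on which
    [h] has mean 0; for [N = 0] the kernels of order at most [M 0 = 1] are 0. For
    [n > M N] the modulus of the kernel is summed over its ranks [a]: the ranks
    [a <= N] make up the majorant, in which the factor [(M N)^-1] comes from
    [n > M N], and the ranks beyond [N] contribute [\sum M a <= 2 * n] times the
    mass of rank [N], up to a constant. *)
Lemma fejer_atom_le N L P (h : vseq m -> R[i]) (c : R) n x :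
  (N <= L)%N -> (n <= vM m L)%N -> level N P -> 0 <= c ->
  (forall t, cmod (h t) <= c * (P t)%:R) ->
  (N = 0%N \/ forall t, avg (iota N (L - N)) h t = 0) ->
  cmod (mean L (fun t => fejer R n x t * h t)) <=
  n%:R * (atom_const * c * atom_majorant N P x).
Proof.
move=> NL nL PN c0 hc h0.
have maj0 := atom_majorant_ge0 N P x.
have K0 : 0 <= atom_const by rewrite mulr_ge0// exprn_ge0.
have [->|n0] := posnP n.
  rewrite (@mean_ext _ _ _ _ (fun=> 0)) => [|t]; last by rewrite /fejer big_ord0 mul0r.
  by rewrite /mean avg0 cmod0 mul0r.
have [nN|Nn] := leqP n (vM m N).
  case: h0 => [N0|h0].
    have {nN} -> : n = 1%N by move: nN; rewrite N0 vM0; lia.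
    rewrite (@mean_ext _ _ _ _ (fun=> 0)) => [|t]; last first.
      by rewrite /fejer big_ord1 /dirichlet big_ord0 mul0r.
    by rewrite /mean avg0 cmod0 mulr_ge0// mulr_ge0// mulr_ge0.
  rewrite (@meanMl_tower _ _ N)//; last exact: level_fejer.
  rewrite (@mean_ext _ _ _ _ (fun=> 0)) => [|t]; last by rewrite h0 mulr0.
  by rewrite /mean avg0 cmod0 mulr_ge0// mulr_ge0// mulr_ge0.
(* [T] is the rank of the leading digit of [n]. *)
have [T /andP[Tn nT]] := vM_bracket n0.
have NT : (N <= T)%N.
  rewrite leqNgt; apply/negP => TN.
  by have := leq_trans (leq_trans nT (leq_vM m_ge2 TN)) (ltnW Nn); rewrite ltnn.
have TL : (T <= L)%N.
  rewrite leqNgt; apply/negP => LT.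
  have := leq_trans (leq_vM m_ge2 LT) (leq_trans Tn nL).
  by rewrite leqNgt -(ltr_nat R) (lt_le_trans _ (M2 L))// /M; have := M_gt0 L; rewrite /M; lra.
apply: le_trans (cmod_avg _ _ _) _.
apply: (@le_trans _ _ (mean L (fun t => c * (3 * B%:R ^+ 2) *
    \sum_(a < T.+1) \sum_(s < a.+1) M a * M s * slice P a s x t))).
  apply: mean_le => t; rewrite cmodM.
  have hF := cmod_fejer R m_ge2 mB x t nT.
  apply: le_trans (ler_pM (cmod_ge0 _) (cmod_ge0 _) hF (hc t)) _.
  have <- : (\sum_(a < T.+1) M a * majorant R a x t) * (P t)%:R =
      \sum_(a < T.+1) \sum_(s < a.+1) M a * M s * slice P a s x t.
    rewrite mulr_suml; apply: eq_bigr => a _; rewrite mulrAC /majorant mulr_sumr.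
    by apply: eq_bigr => s _; rewrite /slice /M -mulnb natrM; ring.
  by rewrite le_eqVlt; apply/orP; left; apply/eqP; rewrite /M; ring.
rewrite meanZ mean_sum.
rewrite (eq_bigr (fun a : 'I_T.+1 => M a * mass L P a x)); last first.
  move=> a _; rewrite mean_sum /mass mulr_sumr; apply: eq_bigr => s _.
  by rewrite meanZ mulrA.
have Mn : M T <= n%:R by rewrite ler_nat.
have hlow : \sum_(a < N.+1) M a * mass L P a x = M N * atom_majorant N P x.
  rewrite mulVKf ?gt_eqF//; apply: eq_bigr => a _.
  by rewrite (mass_widen _ PN)// NL -ltnS ltn_ord.
have hS : \sum_(a < T.+1) M a * mass L P a x <= 7 * B%:R * n%:R * atom_majorant N P x.
  rewrite (bigID (fun a : 'I_T.+1 => (a < N.+1)%N))/=.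
  rewrite (sum_ord_lt (fun a => M a * mass L P a x))// hlow.
  rewrite (_ : 7 * _ * _ * _ = B%:R * (n%:R * atom_majorant N P x) +
     6 * B%:R * n%:R * atom_majorant N P x); last by ring.
  rewrite lerD//.
    apply: (@le_trans _ _ (n%:R * atom_majorant N P x)).
      by rewrite ler_wpM2r// (le_trans _ Mn)// M_le.
    by rewrite ler_peMl// mulr_ge0.
  apply: (@le_trans _ _ (\sum_(a < T.+1) M a * (3 * B%:R * atom_majorant N P x))).
    rewrite big_mkcond; apply: ler_sum => a _; case: ifPn => aN; last first.
      by rewrite mulr_ge0 ?(ltW (M_gt0 _))// mulr_ge0// mulr_ge0.
    have aNL : (N <= a <= L)%N.
      by rewrite (leq_trans _ TL) -ltnS ?ltn_ord// andbT ltnW// ltnNge.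
    rewrite ler_wpM2l ?(ltW (M_gt0 _))//; apply: le_trans (mass_le x PN aNL) _.
    rewrite ler_wpM2l ?mulr_ge0// (mass_widen _ PN) ?leqnn//.
    exact: mass_le_atom_majorant.
  rewrite -mulr_suml; apply: le_trans (ler_wpM2r _ (sum_vM T)) _.
    by rewrite mulr_ge0// mulr_ge0.
  rewrite (_ : 6 * _ * _ * _ = 2 * n%:R * (3 * B%:R * atom_majorant N P x)); last by ring.
  by apply: ler_wpM2r; [rewrite mulr_ge0// mulr_ge0 | rewrite ler_wpM2l].
apply: le_trans (ler_wpM2l _ hS) _; first by rewrite !mulr_ge0// exprn_ge0.
by rewrite /atom_const le_eqVlt; apply/orP; left; apply/eqP; ring.
Qed.

(** [atom_majorant] is a sum of multiples of indicator functions, one for each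
    cylinder of rank [N] in [P] and each pair [s <= A <= N]. Weak [L_(1/2)] has
    no norm, but truncated functions can be added, and the truncated sum over
    [s] and [A] is the one of [lacunary_min2]. *)
Lemma atom_majorant_weak N P (c : R) :
  level N P -> 0 < c ->
  mean N (fun x => Num.min (c * atom_majorant N P x) 1) <=
  16 * B%:R * Num.sqrt c * mean N (fun x => (P x)%:R).
Proof.
move=> PN c0; (* The height of the part of the majorant that belongs to one cylinder. *)
pose r A s : R := c * M A * M s / M N ^+ 2.
have r0 A s : 0 <= r A s by rewrite !mulr_ge0 ?invr_ge0 ?exprn_ge0// ltW.
have MN0 := M_gt0 N.
have MN : (\prod_(k <- iota 0 N) m k)%:R = M N :> R.
  by rewrite /M /vM -(big_mkord xpredT m) /index_iota subn0.
have rM0 A s x t : 0 <= r A s * M N * slice P A s x t.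
  exact: mulr_ge0 (mulr_ge0 (r0 _ _) (ltW MN0)) (slice_ge0 _ _ _ _ _).
pose I A s := mean N (fun x => mean N (slice P A s x)).
apply: (@le_trans _ _ (\sum_(A < N.+1) \sum_(s < A.+1) M N * (Num.min (r A s) 1 * I A s))).
  rewrite (eq_bigr (fun A : 'I_N.+1 => mean N (fun x => \sum_(s < A.+1)
      M N * (Num.min (r A s) 1 * mean N (slice P A s x))))); last first.
    move=> A _; rewrite mean_sum; apply: eq_bigr => s _.
    by rewrite meanZ meanZ.
  rewrite -mean_sum; apply: mean_le => x.
  have -> : c * atom_majorant N P x =
      \sum_(A < N.+1) \sum_(s < A.+1) mean N (fun t => r A s * M N * slice P A s x t).
    rewrite /atom_majorant mulrA mulr_sumr; apply: eq_bigr => A _.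
    rewrite /mass !mulr_sumr; apply: eq_bigr => s _; rewrite meanZ !mulrA; congr (_ * _).
    by rewrite /r; field; rewrite gt_eqF.
  apply: le_trans (min_sum_le _ _ _ ler01) _.
    by move=> A; apply: sumr_ge0 => s _; rewrite mean_ge0// => t; exact: rM0.
  apply: ler_sum => A _; apply: le_trans (min_sum_le _ _ _ ler01) _.
    by move=> s; rewrite mean_ge0// => t; exact: rM0.
  apply: ler_sum => s _; apply: le_trans (min_avg_le m_ge2 _ _ _ ler01) _.
    by move=> t; exact: rM0.
  rewrite MN ler_wpM2l ?(ltW MN0)// -meanZ; apply: avg_le => t.
  rewrite mulrAC mulfK ?gt_eqF// /slice; case: (P t && _).
    by rewrite !mulr1.
  by rewrite !mulr0 minEle ler01.
have hI A s : (A <= N)%N -> I A s <= B%:R / M A * mean N (fun x => (P x)%:R).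
  move=> AN; rewrite /I [mean _ _]avg_exchange -meanZ; apply: mean_le => t.
  rewrite (@avg_ext _ _ _ _ (fun x => (P t)%:R * (eq_except 0 A s t x)%:R)) => [|x]; last first.
    by rewrite /slice -natrM mulnb eq_exceptC.
  rewrite avgZ mulrC ler_wpM2r// (avg_widen m_ge2 _ AN); last first.
    by move=> x u xu; rewrite (@level_eq_except m 0 A s t _ _ xu).
  by have := @avg_eq_except_le R m m_ge2 B 0 A s t (fun=> 0) mB; rewrite vM0 mulr1.
pose w := M N / Num.sqrt c.
have sc0 : 0 < Num.sqrt c by rewrite sqrtr_gt0.
have w0 : 0 < w by rewrite divr_gt0.
have p0 : 0 <= mean N (fun x => (P x)%:R) :> R by rewrite mean_ge0.
apply: (@le_trans _ _ (\sum_(A < N.+1) \sum_(s < A.+1)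
    (B%:R * mean N (fun x => (P x)%:R) * (c / M N)) * Num.min (M s) (w ^+ 2 / M A))).
  apply: ler_sum => A _; apply: ler_sum => s _.
  have := hI A s; rewrite -ltnS ltn_ord => /(_ isT) h.
  apply: le_trans (ler_wpM2l _ (ler_wpM2l _ h)) _.
  - by rewrite ltW.
  - by rewrite le_min r0 ler01.
  rewrite (_ : _ * (_ * _) = B%:R * mean N (fun x => (P x)%:R) *
     (M N / M A * Num.min (r A s) 1)); last by ring.
  rewrite -[leRHS]mulrA ler_wpM2l ?mulr_ge0//.
  have MA0 := M_gt0 A.
  rewrite -!minMl ?divr_ge0 ?(ltW c0) ?(ltW MN0) ?(ltW MA0)//.
  rewrite le_eqVlt; apply/orP; left; apply/eqP; congr Num.min.
    by rewrite /r; field; rewrite !gt_eqF.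
  rewrite mulr1 /w exprMn exprVn sqr_sqrtr ?ltW//.
  by field; rewrite !gt_eqF.
under eq_bigr do rewrite -mulr_sumr; rewrite -mulr_sumr.
apply: le_trans (ler_wpM2l _ (lacunary_min2 _ w0 M_gt0 M2)) _.
  by rewrite !mulr_ge0 ?invr_ge0 ?(ltW c0) ?(ltW MN0).
rewrite le_eqVlt; apply/orP; left; apply/eqP.
rewrite /w -{1}(sqr_sqrtr (ltW c0)); field.
by rewrite !gt_eqF.
Qed.

End atoms.

(** * The maximal inequality at a finite level *)

Section martingales.
Context (R : realType) (m : nat -> nat) (m_ge2 : forall k, (2 <= m k)%N).
Context (B : nat) (mB : forall k, (m k <= B)%N).
Context (f : nat -> vseq m -> R[i]).
Hypothesis f_level : forall n, level n (f n).
Hypothesis f_avg : forall n, coordavg n (f n.+1) =1 f n.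
Implicit Types (x t u : vseq m) (c : R) (N L j : nat).

(** A predictable majorant: [envelope N.+1] bounds [f N.+1], but only depends on
    the coordinates before [N]. Stopping according to it keeps the stopped
    martingale bounded by the threshold. *)
Fixpoint envelope N t : R :=
  if N is N'.+1 then
    Num.max (envelope N' t) (\big[Num.max/0]_(d : 'Z_(m N')) cmod (f N'.+1 (upd t d)))
  else cmod (f 0%N t).

Arguments envelope : simpl never.

Lemma envelopeS N t : envelope N.+1 t =
  Num.max (envelope N t) (\big[Num.max/0]_(d : 'Z_(m N)) cmod (f N.+1 (upd t d))).
Proof. by []. Qed.

Lemma level_envelopeS N : level N (envelope N.+1) /\ level N (envelope N).
Proof.
have step j : level j (envelope j) -> level j (envelope j.+1).
  move=> ih t u tu; rewrite !envelopeS (ih _ _ tu); congr Num.max.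
  by apply: eq_bigr => d _; congr cmod; exact/f_level/agree_updS.
elim: N => [|N [ihS ih]].
  have W0 : level 0 (envelope 0) by move=> t u tu; rewrite /envelope (f_level tu).
  by split=> //; exact: step.
have h : level N.+1 (envelope N.+1) by apply: levelW ihS.
by split=> //; exact: step.
Qed.

Lemma level_envelope N : level N (envelope N). Proof. by case: (level_envelopeS N). Qed.

Lemma envelope_leS N t : envelope N t <= envelope N.+1 t.
Proof. by rewrite envelopeS le_max lexx. Qed.

Lemma envelope_le N N' t : (N <= N')%N -> envelope N t <= envelope N' t.
Proof. by move/subnK<-; elim: (N' - N)%N => // j ih; apply: le_trans ih (envelope_leS _ _). Qed.

Lemma envelope_ge0 N t : 0 <= envelope N t.
Proof. by apply: le_trans (envelope_le t (leq0n N)); exact: cmod_ge0. Qed.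

Lemma cmod_le_envelope N t : cmod (f N t) <= envelope N t.
Proof.
case: N => [//|N]; rewrite envelopeS le_max; apply/orP; right.
by rewrite -{1}(upd_id t N); exact: (le_bigmax _ (fun d : 'Z_(m N) => cmod (f N.+1 (upd t d)))).
Qed.

(** The martingale stopped just before its modulus may exceed [c], and 0 if it
    exceeds [c] from the start. *)
Definition stopped c L t : R[i] :=
  (if envelope 0 t <= c then f 0%N t else 0) +
  \sum_(j < L) (if envelope j.+1 t <= c then f j.+1 t - f j t else 0).

Lemma stoppedS c L t : stopped c L.+1 t =
  stopped c L t + (if envelope L.+1 t <= c then f L.+1 t - f L t else 0).
Proof. by rewrite /stopped big_ord_recr addrA. Qed.

Lemma stopped_id c L t : envelope L t <= c -> stopped c L t = f L t.
Proof.
elim: L => [|L ih] Wc; first by rewrite /stopped Wc big_ord0 addr0.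
by rewrite stoppedS Wc ih ?subrKC// (le_trans (envelope_leS L t)).
Qed.

Lemma cmod_stopped_le c L t : 0 <= c -> cmod (stopped c L t) <= c.
Proof.
move=> c0; elim: L => [|L ih].
  rewrite /stopped big_ord0 addr0; case: ifP => [/(le_trans _)|_]; last by rewrite cmod0.
  by apply; exact: cmod_le_envelope.
have [Wc|Wc] := leP (envelope L.+1 t) c.
  by rewrite stopped_id// (le_trans (cmod_le_envelope _ _)).
by rewrite stoppedS [envelope _ _ <= c]leNgt Wc addr0.
Qed.

Lemma stopped_stop c N L t : (N <= L)%N -> c < envelope N.+1 t -> stopped c L t = stopped c N t.
Proof.
move=> /subnK<- Wc; elim: (L - N)%N => // j ih.
rewrite addSn stoppedS ih leNgt (lt_le_trans Wc) ?addr0// envelope_le//.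
by rewrite ltnS leq_addl.
Qed.

(** The points at which the martingale is stopped at [N]. The initial value may
    already be too large, in which case stopping occurs at 0. *)
Definition stop_at c N t : bool := ((N == 0%N) || (envelope N t <= c)) && (c < envelope N.+1 t).

Lemma level_stop_at c N : level N (stop_at c N).
Proof.
by move=> t u tu; rewrite /stop_at (level_envelope tu) ((level_envelopeS N).1 _ _ tu).
Qed.

Lemma sum_stop_at c L t : (0 < L)%N ->
  \sum_(N < L) (stop_at c N t)%:R = (c < envelope L t)%R%:R :> R.
Proof.
case: L => // L _; elim: L => [|L ih]; first by rewrite big_ord1.
rewrite big_ord_recr ih /= /stop_at /= leNgt; have WL := envelope_leS L.+1 t.
by case: (ltP c (envelope L.+1 t)) => [/lt_le_trans/(_ WL)->|_] /=; rewrite ?addr0 ?add0r.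
Qed.

Definition atom c c' L N t : R[i] := (stop_at c N t)%:R * (stopped c' L t - stopped c L t).

(** Where the martingale is never stopped at the lower threshold, the two
    stopped martingales coincide. *)
Lemma sum_atom c c' L t : c <= c' -> (0 < L)%N ->
  stopped c' L t - stopped c L t = \sum_(N < L) atom c c' L N t.
Proof.
move=> cc' L0; rewrite -mulr_suml.
have -> : \sum_(N < L) (stop_at c N t)%:R = (c < envelope L t)%R%:R :> R[i].
  have := congr1 (real_complex R) (sum_stop_at c t L0).
  by rewrite rmorph_sum /= rmorph_nat => <-; apply: eq_bigr => N _; rewrite natrC.
case: ltP => [_|Wc]; first by rewrite mul1r.
by rewrite !stopped_id ?subrr ?mulr0// (le_trans Wc).
Qed.

Lemma cmod_atom_le c c' L N t : 0 <= c -> 0 <= c' ->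
  cmod (atom c c' L N t) <= (c' + c) * (stop_at c N t)%:R.
Proof.
move=> c0 c'0; rewrite cmodM cmod_nat mulrC ler_wpM2r//.
by apply: le_trans (cmodB _ _) _; rewrite lerD// cmod_stopped_le.
Qed.

(** A stopped increment is an increment times a factor that is determined by the
    coordinates before it. *)
Lemma avg_increment c N L j t : (N <= j < L)%N ->
  avg (iota N (L - N)) (fun u => if envelope j.+1 u <= c then f j.+1 u - f j u else 0) t = 0.
Proof.
move=> /andP[Nj jL]; have -> : (L - N = (j - N) + (L - j))%N by lia.
rewrite iotaD avg_cat subnKC// (_ : L - j = (L - j.+1).+1)%N; last by lia.
rewrite (@avg_ext _ _ _ _ (fun=> 0)) ?avg0// => u; rewrite avg_cons.
rewrite (@coordavg_ext _ _ _ _ (fun u => (envelope j.+1 u <= c)%R%:R * (f j.+1 u - f j u))).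
  rewrite coordavgMl; last first.
    by move=> d; rewrite ((level_envelopeS j).1 _ u)//; exact: agree_upd_out.
  have := f_avg j u; rewrite /coordavg sumrB mulrBr => ->.
  have := @coordavg_cst _ m_ge2 _ j (f j) u; rewrite /coordavg => ->.
    by rewrite subrr mulr0.
  by move=> d; apply/f_level/agree_upd_out.
move=> v; rewrite (@avg_iota_level _ m_ge2 _ j.+1)//.
  by case: ifP => _; rewrite ?mul1r ?mul0r.
move=> w z wz; rewrite (level_envelope wz) (f_level wz).
by rewrite (f_level (agreeW (leqnSn j) wz)).
Qed.

Lemma avg_atom c c' L N t : c <= c' -> (0 < N <= L)%N ->
  avg (iota N (L - N)) (atom c c' L N) t = 0.
Proof.
move=> cc' /andP[N0 NL].
rewrite (@avg_ext _ _ _ _ (fun u => (stop_at c N u)%:R *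
   \sum_(N <= j < L) (if envelope j.+1 u <= c' then f j.+1 u - f j u else 0))); last first.
  move=> u; rewrite /atom /stop_at gtn_eqF//=.
  case: andP => [[WN cW]|_]; last by rewrite !mul0r.
  rewrite (stopped_stop NL cW) (stopped_id WN) !mul1r.
  rewrite -(stopped_id (le_trans WN cc')) /stopped.
  rewrite -(big_mkord xpredT (fun j => if envelope j.+1 u <= c' then f j.+1 u - f j u else 0)).
  rewrite -[in X in _ - X](big_mkord xpredT
    (fun j => if envelope j.+1 u <= c' then f j.+1 u - f j u else 0)).
  by rewrite (@big_cat_nat _ _ _ N 0 L)//= addrA [LHS]addrC addKr.
rewrite (@avg_iotaMl _ _ N)//; last by move=> u v uv; rewrite (level_stop_at _ uv).
rewrite avg_sum big_nat_cond big1 ?mulr0// => j; rewrite andbT => Nj.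
exact: avg_increment.
Qed.

Definition maxf L t : R := \big[Num.max/0]_(n < L.+1) cmod (f n t).

Lemma cmod_le_maxf n L t : (n <= L)%N -> cmod (f n t) <= maxf L t.
Proof.
by rewrite -ltnS => nL; exact: (le_bigmax _ (fun n : 'I_L.+1 => cmod (f n t)) (Ordinal nL)).
Qed.

Lemma maxf_ge0 L t : 0 <= maxf L t.
Proof. exact: le_trans (cmod_ge0 _) (cmod_le_maxf t (leq0n L)). Qed.

Lemma level_maxf L : level L (maxf L).
Proof.
move=> t u tu; apply: eq_bigr => n _; rewrite (@f_level n _ u)//.
by apply: agreeW tu; rewrite -ltnS.
Qed.

(** Stopping happens because the martingale exceeds [c] on one of the at most [B]
    subcylinders; the envelope is therefore not much larger in measure than the
    maximal function. *)
Lemma mean_stop_at_le c L N : 0 <= c -> (N < L)%N ->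
  mean N (fun t => (stop_at c N t)%:R) <=
  B%:R * mean L (fun t => (stop_at c N t)%:R * (c < maxf L t)%R%:R) :> R.
Proof.
move=> c0 NL; pose Q t := (c < cmod (f 0%N t)) || (c < cmod (f N.+1 t)).
have levQ : level N.+1 Q.
  by move=> t u tu; rewrite /Q (f_level tu) (@f_level 0%N t u).
have levP : level N (fun t => (stop_at c N t)%:R : R).
  by move=> t u tu; rewrite (level_stop_at _ tu).
apply: (@le_trans _ _ (B%:R * mean L (fun t => (stop_at c N t)%:R * (Q t)%:R))); last first.
  rewrite ler_wpM2l//; apply: mean_le => t; rewrite ler_wpM2l// ler_nat.
  case: (boolP (Q t)) => // /orP[] /lt_le_trans ->//; exact: cmod_le_maxf.
rewrite (mean_widen m_ge2 NL); last first.
  by move=> t u tu; rewrite (levQ _ _ tu) (levP t u)//; apply: agreeW tu.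
rewrite (@meanMl_tower _ _ N)// subSnn/= -meanZ; apply: mean_le => t.
case: (boolP (stop_at c N t)) => [|_]; last by rewrite mul0r mulr0.
move=> /andP[WN cW]; rewrite mul1r.
have mN : (m N)%:R != 0 :> R by exact: mkF_neq0.
have mBR : (m N)%:R <= B%:R :> R by rewrite ler_nat.
suff [d Qd] : exists d : 'Z_(m N), Q (upd t d).
  rewrite /coordavg mulrA; apply: (@le_trans _ _ (1 * \sum_(d : 'Z_(m N)) (Q (upd t d))%:R)).
    by rewrite mul1r (bigD1 d)//= Qd lerDl sumr_ge0.
  by rewrite ler_wpM2r ?sumr_ge0// ler_pdivlMr ?mul1r// lt_neqAle eq_sym mN/=.
move: cW; rewrite envelopeS lt_max => /orP[cW|].
  move: WN; case: (N =P 0%N) cW => [N0|_] /= cW; last by rewrite leNgt cW.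
  move=> _; exists 0; rewrite /Q; apply/orP; left.
  rewrite N0 /= in cW; rewrite (@f_level 0%N _ t)//.
move=> /bigmax_gtP[|[d _ cd]]; first by rewrite ltNge c0.
by exists d; rewrite /Q cd orbT.
Qed.

(** ** Adding up the atoms *)

Lemma level_le_mean L (g : vseq m -> R) t : level L g -> (forall t, 0 <= g t) ->
  g t <= (vM m L)%:R * mean L g.
Proof.
move=> gL g0; rewrite -(avg_mean t gL).
have -> : vM m L = (\prod_(k <- iota 0 L) m k)%N.
  by rewrite /vM -(big_mkord xpredT m) /index_iota subn0.
elim: (iota 0 L) t => [|k s ih] t; first by rewrite big_nil mul1r.
apply: le_trans (ih t) _; rewrite big_cons mulnC natrM -mulrA ler_wpM2l//.
rewrite avg_cons /coordavg mulVKf ?mkF_neq0// (bigD1 (t k))//= upd_id.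
by rewrite lerDl sumr_ge0// => d _; exact: avg_ge0.
Qed.

Lemma geo_sum2_le (a v : R) K : 0 <= a -> 0 <= v ->
  \sum_(k < K) a * 2 ^+ k * (a * 2 ^+ k < v)%R%:R <= 2 * v.
Proof.
move=> a0 v0; have full n : \sum_(k < n) a * 2 ^+ k <= a * 2 ^+ n.
  elim: n => [|n ih]; first by rewrite big_ord0 mulr1.
  by rewrite big_ord_recr/= exprS; lra.
elim: K => [|K ih]; first by rewrite big_ord0 mulr_ge0.
case: (ltP (a * 2 ^+ K) v) => h; last first.
  by rewrite big_ord_recr/= ltNge h mulr0 addr0.
apply: (@le_trans _ _ (\sum_(k < K.+1) a * 2 ^+ k)).
  apply: ler_sum => k _; rewrite ler_piMr ?lern1 ?leq_b1//.
  by rewrite mulr_ge0// exprn_ge0.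
by apply: le_trans (full _) _; rewrite exprS; lra.
Qed.

Definition weak_const : R := 32 * B%:R ^+ 2 * Num.sqrt (10 * atom_const R B).

Lemma atom_const_gt0 : 0 < atom_const R B.
Proof.
rewrite mulr_gt0// exprn_gt0// ltr0n.
exact: leq_trans (leq_trans _ (m_ge2 0%N)) (mB 0%N).
Qed.

(** The maximal Fejer operator is of weak type [1 / 2]. The martingale is cut at
    the thresholds [c k = eps * 4 ^+ k]; the pieces between [c k] and [c k.+1]
    are atoms, supported where it is stopped at [c k]. The truncated majorants
    of these atoms have a total integral of order
    [\sum_k Num.sqrt (c k / lam) * mu (maxf > c k)], and the sum over [k] of
    [Num.sqrt (c k)] below [maxf] is comparable to [Num.sqrt maxf]. *)
Lemma fejer_weak L (lam : R) (E : pred (vseq m)) : (0 < L)%N -> 0 < lam ->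
  (forall x, E x -> exists n, [/\ (0 < n)%N, (n <= vM m L)%N &
     n%:R * lam < cmod (mean L (fun t => fejer R n x t * f L t))]) ->
  mean L (fun x => (E x)%:R) <=
  weak_const / Num.sqrt lam * mean L (fun t => Num.sqrt (maxf L t)).
Proof.
move=> L0 lam0 hE.
have [AC [ACE AC0]] : exists AC : R, AC = atom_const R B /\ 0 < AC.
  by exists (atom_const R B); split => //; exact: atom_const_gt0.
(* With this [eps], the part of the martingale below the lowest threshold
   contributes at most [lam / 2]. *)
pose eps := lam / (2 * AC); have eps0 : 0 < eps by rewrite divr_gt0 ?mulr_gt0.
pose c k := eps * 4 ^+ k.
have c0 k : 0 < c k by rewrite mulr_gt0// exprn_gt0.
have cS k : c k.+1 = 4 * c k by rewrite /c exprS; ring.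
(* A function of finite level is bounded, so finitely many thresholds suffice. *)
have [K WK] : exists K, forall t, envelope L t <= c K.
  pose b := (vM m L)%:R * mean L (envelope L) / eps.
  exists (Num.truncn b).+1 => t; apply: le_trans (level_le_mean _ (@level_envelope L) (envelope_ge0 L)) _.
  have b0 : 0 <= b.
    rewrite divr_ge0 ?(ltW eps0)// mulr_ge0// mean_ge0// => u; exact: envelope_ge0.
  rewrite /c [leRHS]mulrC -ler_pdivrMr// -/b.
  apply: le_trans (ltW (truncnS_gt b)) _.
  by rewrite -natrX ler_nat ltnW// ltn_expl.
pose D x := \sum_(k < K) \sum_(N < L) 10 * AC / lam * c k * atom_majorant R N (stop_at (c k) N) x.
have fE t : f L t = stopped (c 0%N) L t + \sum_(k < K) \sum_(N < L) atom (c k) (c k.+1) L N t.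
  rewrite (eq_bigr (fun k : 'I_K => stopped (c k.+1) L t - stopped (c k) L t)); last first.
    by move=> k _; rewrite -sum_atom// cS; have := c0 k; lra.
  rewrite -(big_mkord xpredT (fun k => stopped (c k.+1) L t - stopped (c k) L t)).
  by rewrite telescope_sumr// subrKC stopped_id.
have hD x n : (0 < n)%N -> (n <= vM m L)%N ->
    cmod (mean L (fun t => fejer R n x t * f L t)) <= n%:R * (lam / 2) * (1 + D x).
  move=> n0 nL.
  rewrite (@mean_ext _ _ _ _ (fun t => fejer R n x t * stopped (c 0%N) L t + \sum_(k < K)
     \sum_(N < L) fejer R n x t * atom (c k) (c k.+1) L N t)); last first.
    by move=> t; rewrite fE mulrDr mulr_sumr; under eq_bigr do rewrite mulr_sumr.
  rewrite meanD mulrDr mulr1; apply: le_trans (cmodD _ _) _; rewrite lerD//.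
    apply: le_trans (@fejer_atom_le R m m_ge2 B mB 0 L xpredT _ eps n x _ _ _ _ _ _) _ => //.
    - exact: ltW.
    - by move=> t; rewrite mulr1 -[eps]mulr1 -(expr0 4) cmod_stopped_le// ltW.
    - by left.
    have -> : atom_majorant R 0 xpredT x = 1.
      rewrite /atom_majorant big_ord1 /mass big_ord1 /slice /= !vM0 invr1 !mul1r.
      by rewrite /mean.
    by rewrite mulr1 /eps -ACE ler_wpM2l// le_eqVlt; apply/orP; left; apply/eqP; field; rewrite gt_eqF.
  rewrite mean_sum; apply: le_trans (cmod_sum _ _ _) _; rewrite mulr_sumr.
  apply: ler_sum => k _; rewrite mean_sum mulr_sumr.
  apply: le_trans (cmod_sum _ _ _) _; apply: ler_sum => N _.
  have cc : c k <= c k.+1 by rewrite cS; have := c0 k; lra.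
  apply: le_trans (@fejer_atom_le R m m_ge2 B mB N L (stop_at (c k) N) _
    (c k.+1 + c k) n x _ _ _ _ _ _) _ => //.
  - exact: ltnW.
  - exact: level_stop_at.
  - by rewrite addr_ge0// ltW.
  - by move=> t; apply: cmod_atom_le; exact: ltW.
  - have [N0|N0] := posnP N; [by left | right => t].
    by apply: avg_atom => //; rewrite N0 ltnW.
  rewrite cS -[leRHS]mulrA ler_wpM2l// -ACE le_eqVlt; apply/orP; left; apply/eqP.
  by field; rewrite gt_eqF.
have Dge0 k N x : 0 <= 10 * AC / lam * c k * atom_majorant R N (stop_at (c k) N) x.
  apply: mulr_ge0 (atom_majorant_ge0 _ _ _ _).
  exact: mulr_ge0 (divr_ge0 (mulr_ge0 (ler0n _ 10) (ltW AC0)) (ltW lam0)) (ltW (c0 k)).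
have ED x : (E x)%:R <= Num.min (D x) 1.
  case: (boolP (E x)) => [/hE [n [n0 nL hn]]|_]; last first.
    by rewrite le_min ler01 andbT sumr_ge0// => k _; rewrite sumr_ge0.
  rewrite le_min lexx andbT leNgt; apply/negP => D1.
  have := lt_le_trans hn (hD x n n0 nL); rewrite -mulrA ltr_pM2l ?ltr0n//.
  have h1 : 0 < 1 - D x by rewrite subr_gt0.
  by have := mulr_gt0 lam0 h1; lra.
apply: le_trans (mean_le _ ED) _.
apply: (@le_trans _ _ (\sum_(k < K) \sum_(N < L) 16 * B%:R ^+ 2 * Num.sqrt (10 * AC / lam * c k) *
    mean L (fun t => (stop_at (c k) N t)%:R * (c k < maxf L t)%R%:R))).
  apply: (@le_trans _ _ (\sum_(k < K) \sum_(N < L) mean L (fun x =>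
     Num.min (10 * AC / lam * c k * atom_majorant R N (stop_at (c k) N) x) 1))).
    rewrite (eq_bigr (fun k : 'I_K => mean L (fun x => \sum_(N < L)
      Num.min (10 * AC / lam * c k * atom_majorant R N (stop_at (c k) N) x) 1))); last first.
      by move=> k _; rewrite mean_sum.
    rewrite -mean_sum; apply: mean_le => x.
    apply: le_trans (min_sum_le _ _ _ ler01) _ => [k|]; first by rewrite sumr_ge0.
    by apply: ler_sum => k _; exact: min_sum_le.
  apply: ler_sum => k _; apply: ler_sum => N _.
  have ck0 : 0 < 10 * AC / lam * c k by rewrite (mulr_gt0 _ (c0 k))// divr_gt0// mulr_gt0.
  have Pk : level N (stop_at (c k) N) by exact: level_stop_at.
  rewrite (mean_widen m_ge2 (ltnW (ltn_ord N))); last first.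
    by move=> x y xy; rewrite (level_atom_majorant _ _ xy).
  apply: le_trans (atom_majorant_weak m_ge2 mB Pk ck0) _.
  have := mean_stop_at_le (ltW (c0 k)) (ltn_ord N); have := sqrtr_ge0 (10 * AC / lam * c k).
  set X := mean N _; set Y := mean L _; set r := Num.sqrt _ => r0 XY.
  rewrite (_ : 16 * B%:R ^+ 2 * r * Y = 16 * B%:R * r * (B%:R * Y)); last by ring.
  by rewrite ler_wpM2l// mulr_ge0// mulr_ge0.
have sck k : Num.sqrt (c k) = Num.sqrt eps * 2 ^+ k.
  rewrite /c sqrtrM ?(ltW eps0)//; congr (_ * _).
  have -> : 4 ^+ k = (2 ^+ k) ^+ 2 :> R.
    by rewrite exprAC; congr (_ ^+ k); ring.
  by rewrite sqrtr_sqr ger0_norm// exprn_ge0.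
have fac : 0 <= 16 * B%:R ^+ 2 * (Num.sqrt (10 * AC) / Num.sqrt lam) :> R.
  by rewrite mulr_ge0 ?mulr_ge0 ?exprn_ge0 ?invr_ge0 ?sqrtr_ge0.
apply: (@le_trans _ _ (16 * B%:R ^+ 2 * (Num.sqrt (10 * AC) / Num.sqrt lam) *
    mean L (fun t => \sum_(k < K) Num.sqrt (c k) * (c k < maxf L t)%R%:R))).
  rewrite mean_sum mulr_sumr; apply: ler_sum => k _.
  rewrite -mulr_sumr -mean_sum meanZ mulrA.
  have -> : Num.sqrt (10 * AC / lam * c k) =
      Num.sqrt (10 * AC) / Num.sqrt lam * Num.sqrt (c k).
    rewrite sqrtrM; last by rewrite !mulr_ge0 ?invr_ge0 ?ltW.
    by rewrite sqrtrM ?sqrtrV ?mulr_ge0 ?(ltW AC0) ?(ltW lam0).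
  rewrite !mulrA ler_wpM2l ?mulr_ge0 ?sqrtr_ge0//.
  apply: mean_le => t; rewrite -mulr_suml sum_stop_at// ler_piMl// lern1 leq_b1//.
rewrite (_ : weak_const / _ * _ = 16 * B%:R ^+ 2 * (Num.sqrt (10 * AC) / Num.sqrt lam) *
    (2 * mean L (fun t => Num.sqrt (maxf L t)))); last by rewrite /weak_const -ACE; ring.
rewrite ler_wpM2l// -meanZ; apply: mean_le => t.
apply: le_trans (geo_sum2_le K (sqrtr_ge0 eps) (sqrtr_ge0 _)); apply: ler_sum => k _.
rewrite sck -[Num.sqrt eps * _]sck ler_wpM2l ?sqrtr_ge0// ler_nat.
by case: ltP => // h; rewrite ltr_sqrt ?h// (le_lt_trans _ h)// ltW.
Qed.

End martingales.

(** * Integrals of functions of finite level *)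

Section integration.
Context (R : realType) (m : nat -> nat) (m_ge2 : forall k, (2 <= m k)%N).
Implicit Types (x y t : vseq m) (n L : nat).

Lemma lim_near_cstC (u : nat -> R[i]) (l : R[i]) : (\forall k \near \oo, u k = l) ->
  lim ((fun k => u k : R[i]^o) @ \oo) = l.
Proof.
have sep : hausdorff_space (R[i]^o : ptopologicalType) by exact: norm_hausdorff.
by move=> h; exact: (@lim_near_cst (R[i]^o : ptopologicalType) sep _ \oo _ l
  (fun k => u k : R[i]^o) h).
Qed.

Lemma vcylE n x y : vcyl n x y <-> agree n y x.
Proof. by []. Qed.

Lemma level_vcyl n x : level n (vcyl n x).
Proof.
move=> y z yz; apply/propext; split=> h k kn; first by rewrite -yz// h.
by rewrite yz// h.
Qed.

(** A set of level [n] is a countable union of cylinders of rank [n], namely of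
    those around the points [y u] that belong to it. *)
Lemma sigma_level (C : set (set (vseq m))) n (S : set (vseq m)) :
  @vcyls m n `<=` C -> level n S -> <<s C >> S.
Proof.
move=> nC Sn; pose y (u : seq nat) : vseq m := fun i => inZp (nth 0%N u i).
have -> : S = \bigcup_u (if `[< S (y u) >] then vcyl n (y u) else set0).
  apply/seteqP; split => [x /= Sx|x [u _ /=]]; last first.
    by case: asboolP => // Su /vcylE xu; rewrite (Sn _ _ xu).
  pose u := [seq (x i : nat) | i <- iota 0 n].
  have yu : agree n x (y u).
    move=> i ni; rewrite /y (nth_map 0%N) ?size_iota// nth_iota// add0n.
    by rewrite valZpK.
  by exists u => //=; rewrite asboolT// -(Sn _ _ yu).
apply: (@countable_bigcupT_measurable _ (g_sigma_algebraType C)) => // u.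
case: ifP => // _; apply: sub_sigma_algebra; apply: nC.
by exists (y u).
Qed.

(** The sets of level [n] form a sigma-algebra. *)
Lemma level_sigma n (S : set (vseq m)) : <<s @vcyls m n >> S -> level n S.
Proof.
move: S; apply: smallest_sub; last by move=> _ [x _ <-]; exact: level_vcyl.
split.
- by [].
- by move=> A An x y xy; rewrite /setD /mkset (An _ _ xy).
- move=> A An x y xy; apply/propext; split=> -[k _ Ak]; exists k => //.
    by rewrite -(An k _ _ xy).
  by rewrite (An k _ _ xy).
Qed.

Lemma measurable_level n (S : set (vseq m)) : level n S -> measurable (S : set (Gm m)).
Proof. by move=> Sn; apply: (sigma_level _ Sn); exact: bigcup_sup. Qed.

Lemma measurable_fun_level n d (T : measurableType d) (g : vseq m -> T) : level n g ->
  measurable_fun [set: Gm m] (g : Gm m -> T).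
Proof.
move=> gn _ Y _; rewrite setTI; apply: (@measurable_level n).
by move=> x y xy; rewrite /preimage /mkset (gn _ _ xy).
Qed.

Lemma Fn_measurable_level n (g : Gm m -> R[i]) : Fn_measurable n g <-> level n g.
Proof.
split=> [[mRe mIm] x y xy|gn]; last first.
  split=> _ Y _; rewrite setTI; apply: (@sigma_level (@vcyls m n) n) => //.
    by move=> x y xy; rewrite /preimage /mkset (gn _ _ xy).
  by move=> x y xy; rewrite /preimage /mkset (gn _ _ xy).
have H (h : Gm m -> R) : measurable_fun [set: g_sigma_algebraType (@vcyls m n)] h ->
    h x = h y.
  move=> mh; have := mh measurableT [set h y] (measurable_set1 _).
  by rewrite setTI => /level_sigma/(_ _ _ xy)/= ->.
have := H _ mRe; have := H _ mIm.
by case: (g x) (g y) => a b [c d] /= -> ->.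
Qed.

Context (mu : probability (Gm m) R) (mu_prod : product_of_uniforms mu).

Lemma measure_vcyl n x : mu (vcyl n x) = ((vM m n)%:R^-1)%:E.
Proof.
have -> : vcyl n x = [set y | forall k, (k < n)%N -> y k \in [set x k]%SET].
  by apply/seteqP; split=> y h k /h; rewrite inE => /eqP.
rewrite mu_prod; congr EFin; rewrite /vM natr_prod -prodfV; apply: eq_bigr => k _.
by rewrite cards1 mul1r.
Qed.

Lemma vcyl_split n x :
  vcyl n x = \big[setU/set0]_(d <- enum 'Z_(m n)) vcyl n.+1 (upd x d).
Proof.
rewrite -bigcup_seq; apply/seteqP; split=> [y xy|y [d _ yd]].
  exists (y n); first by rewrite /= mem_enum.
  apply/vcylE/agreeS; split; last by rewrite updE.
  by move=> k kn; rewrite updN ?gtn_eqF// xy.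
by move=> k kn; rewrite (yd k (ltnW kn)) updN// gtn_eqF.
Qed.

Lemma integral_vcyl l n (g : vseq m -> R) x : level (n + l) g ->
  (\int[mu]_(y in (vcyl n x : set (Gm m))) (g y)%:E)%E =
  ((vM m n)%:R^-1 * avg (iota n l) g x)%:E.
Proof.
elim: l n x => [|l ih] n x gn.
  rewrite (eq_integral (cst (g x)%:E)) => [|y]; last first.
    by rewrite inE => xy; congr EFin; apply: gn; rewrite addn0; exact/vcylE.
  rewrite integral_cst; last exact: measurable_level (@level_vcyl n x).
  transitivity ((g x)%:E * ((vM m n)%:R^-1)%:E)%E; last by rewrite -EFinM mulrC.
  by congr (_ * _)%E; exact: measure_vcyl.
rewrite vcyl_split integral_bigsetU_EFin ?enum_uniq//.
- have gn' : level (n.+1 + l) g by rewrite addSnnS.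
  rewrite big_enum; under eq_bigr => d _ do rewrite (ih n.+1 _ gn').
  rewrite [iota n l.+1]/= avg_cons /coordavg.
  by rewrite sumEFin -mulr_sumr mulrA vMS natrM invfM.
- by move=> d; exact: measurable_level (@level_vcyl n.+1 _).
- move=> d e _ _ [y [yd ye]].
  by have := yd n (ltnSn n); rewrite updE => <-; have := ye n (ltnSn n); rewrite updE.
apply/measurable_EFinP; apply: measurable_funS (measurableT) (@subsetT _ _) _.
exact: measurable_fun_level gn.
Qed.

Lemma vcyl0 x : vcyl 0 x = setT.
Proof. by apply/seteqP; split. Qed.

Lemma integral_level L (g : vseq m -> R) : level L g ->
  (\int[mu]_(y in [set: Gm m]) (g y)%:E)%E = (mean L g)%:E.
Proof.
move=> gL; rewrite -(vcyl0 (fun=> 0)) (@integral_vcyl L 0)// vM0 invr1 mul1r.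
by rewrite /mean.
Qed.

Lemma measure_level L (E : pred (vseq m)) : level L E ->
  mu [set x | E x] = (mean L (fun x => (E x)%:R))%:E.
Proof.
move=> EL; rewrite -(integral_level (g := fun x => (E x)%:R)); last first.
  by move=> x y xy; rewrite (EL _ _ xy).
have mE : measurable ([set x | E x] : set (Gm m)).
  by apply: (@measurable_level L) => x y xy; rewrite /mkset (EL _ _ xy).
rewrite -[LHS]mul1e -integral_cst// integral_mkcond.
apply: eq_integral => x _; rewrite patchE; case: ifPn; rewrite ?inE ?notin_setE/=.
  by move=> ->.
by move=> /negP/negbTE ->.
Qed.

Lemma cintegral_vcyl l n (g : vseq m -> R[i]) x : level (n + l) g ->
  cintegral mu (vcyl n x) g = (vM m n)%:R^-1 * avg (iota n l) g x.
Proof.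
move=> gn; rewrite /cintegral /Rintegral.
rewrite !(@integral_vcyl l n)//; last first.
- by move=> y z yz; rewrite (gn _ _ yz).
- by move=> y z yz; rewrite (gn _ _ yz).
rewrite /= -Re_avg -Im_avg natrC -fmorphV.
by apply/eqP; rewrite eq_complex /= -!ReZ -!ImZ; case: (avg _ _ _) => a b /=; rewrite !eqxx.
Qed.

Lemma cintegral_level L (g : vseq m -> R[i]) : level L g ->
  cintegral mu setT g = mean L g.
Proof.
by move=> gL; rewrite -(vcyl0 (fun=> 0)) (@cintegral_vcyl L 0)// vM0 invr1 mul1r.
Qed.

(** ** Martingales and their Fourier coefficients *)

Lemma martingale_level (f : nat -> Gm m -> R[i]) n : martingale mu f -> level n (f n).
Proof. by case=> fn _ _; exact/Fn_measurable_level. Qed.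

Lemma martingale_avg (f : nat -> Gm m -> R[i]) n : martingale mu f ->
  coordavg n (f n.+1) =1 (f n : vseq m -> R[i]).
Proof.
move=> mf x; case: (mf) => _ _ /(_ n n.+1 (vcyl n x) (leqnSn n)).
rewrite (@cintegral_vcyl 1 n) ?addn1; last exact: martingale_level.
rewrite (@cintegral_vcyl 0 n) ?addn0; last exact: martingale_level.
have h : <<s @vcyls m n >> (vcyl n x) by apply: sub_sigma_algebra; exists x.
by move=> /(_ h) /mulfI; apply; rewrite invr_neq0// vM_neq0.
Qed.

Lemma avg_iota_martingale (f : nat -> vseq m -> R[i]) n l x :
  (forall n, coordavg n (f n.+1) =1 f n) -> avg (iota n l) (f (n + l)%N) x = f n x.
Proof.
move=> f_avg; elim: l n x => [|l ih] n x; first by rewrite addn0.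
by rewrite avg_cons -addSnnS -(f_avg n x); apply: coordavg_ext => y; exact: ih.
Qed.

Section fixed_martingale.
Context (f : nat -> Gm m -> R[i]) (f_mart : martingale mu f).

Lemma fourier_mean L i : (i < vM m L)%N ->
  fourier mu f i = mean L (fun t => f L t * (vilenkin R i t)^*%C).
Proof.
move=> iL; have lv := level_vilenkin R m_ge2 iL.
rewrite /fourier; apply: lim_near_cstC.
near=> k; have Lk : (L <= k)%N by near: k; exact: nbhs_infty_ge.
have fk : level k (f k) by exact: martingale_level.
rewrite (@cintegral_level k); last first.
  by move=> x y xy; rewrite (fk _ _ xy) (lv _ _ (agreeW Lk xy)).
rewrite (@mean_ext _ _ _ _ (fun t => (vilenkin R i t)^*%C * f k t)); last first.
  by move=> t; rewrite mulrC.
rewrite (@meanMl_tower _ _ L)//; last by move=> x y xy; rewrite (lv _ _ xy).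
by apply: mean_ext => t; have := avg_iota_martingale L (k - L) t (fun n => martingale_avg n f_mart);
  rewrite subnKC// => ->; rewrite mulrC.
Unshelve. all: by end_near. Qed.

Lemma partial_sum_mean L n x : (n <= vM m L)%N ->
  partial_sum mu f n x = mean L (fun t => dirichlet R n x t * f L t).
Proof.
move=> nL; rewrite /partial_sum big_mkord.
rewrite (@mean_ext _ _ _ _ (fun t => \sum_(i < n)
   vilenkin R i x * (f L t * (vilenkin R i t)^*%C))); last first.
  by move=> t; rewrite mulr_suml; apply: eq_bigr => i _; rewrite mulrAC mulrA.
rewrite mean_sum; apply: eq_bigr => i _.
by rewrite meanZ (@fourier_mean L) 1?mulrC// (leq_trans (ltn_ord i)).
Qed.

Lemma sum_partial_sum_mean L n x : (n <= vM m L)%N ->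
  \sum_(k < n) partial_sum mu f k x = mean L (fun t => fejer R n x t * f L t).
Proof.
move=> nL; rewrite (@mean_ext _ _ _ _ (fun t => \sum_(k < n) dirichlet R k x t * f L t)).
  rewrite mean_sum; apply: eq_bigr => k _.
  by rewrite (@partial_sum_mean L)// (leq_trans _ nL)// ltnW.
by move=> t; rewrite mulr_suml.
Qed.

End fixed_martingale.

End integration.

(** * The means T and the weak-type inequality *)

Section Tmeans.
Context (R : realType) (q : nat -> R) (q_ge0 : forall k, 0 <= q k) (q0_gt0 : 0 < q 0%N).
Context (q_mono : {homo q : i j / (i <= j)%N >-> i <= j}).

Lemma q_gt0 k : 0 < q k.
Proof. exact: lt_le_trans q0_gt0 (q_mono (leq0n k)). Qed.

Lemma QsumS n : Qsum q n.+1 = Qsum q n + q n.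
Proof. by rewrite /Qsum big_nat_recr. Qed.

Lemma Qsum_ge_q0 n : (0 < n)%N -> q 0%N <= Qsum q n.
Proof.
case: n => // n _; rewrite /Qsum big_nat_recl//= lerDl.
by rewrite sumr_ge0.
Qed.

Lemma Qsum_gt0 n : (0 < n)%N -> 0 < Qsum q n.
Proof. by move=> /Qsum_ge_q0; exact: lt_le_trans. Qed.

Lemma Qsum_le n : Qsum q n <= n%:R * q n.-1.
Proof.
rewrite /Qsum big_mkord mulr_natl -[X in _ *+ X](card_ord n) -sumr_const.
apply: ler_sum => k _; apply: q_mono; case: n k => [[]//|n] k /=.
by rewrite -ltnS.
Qed.

Lemma bounded_ratio :
  (fun n => q n.-1 / Qsum q n : R^o) =O_\oo (fun n => n%:R^-1 : R^o) ->
  exists2 C : R, 0 < C & forall n, (0 < n)%N -> n%:R * q n.-1 <= C * Qsum q n.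
Proof.
move=> /eqOP hO.
have [k [k0 [N _ hN]]] : exists k : R, 0 < k /\ \forall n \near \oo,
    `|q n.-1 / Qsum q n| <= k * `|n%:R^-1 : R|.
  near +oo_R => k; exists k; split; first by near: k; exact: nbhs_pinfty_gt.
  by near: k; exact: hO.
(* The second term takes care of the finitely many [n < N], for which
   [Qsum q n >= q 0]. *)
exists (k + N%:R * q N / q 0%N).
  by rewrite ltr_pwDl// divr_ge0 ?(ltW q0_gt0)// mulr_ge0.
move=> n n0; have Qn := Qsum_gt0 n0; have n0R : 0 < n%:R :> R by rewrite ltr0n.
rewrite mulrDl; have [nN|Nn] := leqP N n.
  have := hN n nN; rewrite /= !ger0_norm ?invr_ge0 ?divr_ge0 ?(ltW Qn)//.
  rewrite ler_pdivrMr// mulrAC ler_pdivlMr// mulrC => h.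
  by rewrite (le_trans h)// lerDl mulr_ge0 ?(ltW Qn)// divr_ge0 ?(ltW q0_gt0)// mulr_ge0.
apply: (@le_trans _ _ (N%:R * q N / q 0%N * Qsum q n)); last first.
  by rewrite lerDr mulr_ge0// ltW.
rewrite -mulrA; apply: (@le_trans _ _ (N%:R * q N)).
  rewrite ler_pM// ?ler_nat ?(ltnW Nn)//; apply: q_mono.
  by rewrite (leq_trans (leq_pred n))// ltnW.
rewrite ler_peMr ?mulr_ge0// mulrC ler_pdivlMr// mul1r.
exact: Qsum_ge_q0.
Unshelve. all: by end_near. Qed.

Lemma abel_summation (s : nat -> R[i]) n :
  \sum_(k < n.+1) (q k)%:C%C * s k = (q n)%:C%C * \sum_(k < n.+1) s k
  - \sum_(k < n) (q k.+1 - q k)%:C%C * \sum_(i < k.+1) s i.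
Proof.
elim: n => [|n ih]; first by rewrite !big_ord1 big_ord0 subr0.
rewrite big_ord_recr/= ih [in RHS]big_ord_recr/= [X in _ = _ - X]big_ord_recr/=.
by rewrite rmorphB/=; ring.
Qed.

(** As [q] increases, the coefficients of the sums of [s] in [abel_summation]
    have absolute values [q n] and [q k.+1 - q k], and the latter add up to at
    most [q n]. *)
Lemma abel_le (s : nat -> R[i]) n (v : R) : 0 <= v ->
  (forall j, (0 < j <= n.+1)%N -> cmod (\sum_(k < j) s k) <= j%:R * v) ->
  cmod (\sum_(k < n.+1) (q k)%:C%C * s k) <= 2 * (n.+1%:R * q n * v).
Proof.
move=> v0 hs; rewrite abel_summation; apply: le_trans (cmodB _ _) _.
rewrite mulr_natl mulr2n lerD//.
  rewrite cmodM cmod_real ger0_norm// [leRHS]mulrAC [leRHS]mulrC ler_wpM2l//.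
  by apply: hs; rewrite leqnn.
apply: le_trans (cmod_sum _ _ _) _.
apply: (@le_trans _ _ (\sum_(k < n) (q k.+1 - q k) * (n.+1%:R * v))).
  apply: ler_sum => k _; have dq : 0 <= q k.+1 - q k by rewrite subr_ge0 q_mono.
  rewrite cmodM cmod_real ger0_norm// ler_wpM2l//.
  have kn : (0 < k.+1 <= n.+1)%N by rewrite /= ltnS ltnW.
  by apply: le_trans (hs _ kn) _; rewrite ler_wpM2r// ler_nat; case/andP: kn.
rewrite -mulr_suml -(big_mkord xpredT (fun k => q k.+1 - q k)) telescope_sumr//.
by rewrite mulrAC mulrC ler_wpM2l ?mulr_ge0// gerBl.
Qed.

Lemma cmod_Tmean_le m (mu : {measure set (Gm m) -> \bar R}) (f : nat -> Gm m -> R[i])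
    (C v : R) n x : (0 < n)%N -> 0 <= v -> n%:R * q n.-1 <= C * Qsum q n ->
  (forall j, (0 < j <= n)%N -> cmod (\sum_(k < j) partial_sum mu f k x) <= j%:R * v) ->
  cmod (Tmean mu q f n x) <= 2 * C * v.
Proof.
case: n => // n _ v0 hC hs; have Qn := @Qsum_gt0 n.+1 isT.
rewrite /Tmean cmodM cmod_real ger0_norm ?invr_ge0 ?(ltW Qn)// mulrC ler_pdivrMr//.
have h := @abel_le (fun k => partial_sum mu f k x) n v v0 hs.
rewrite big_mkord; apply: le_trans h _.
by rewrite -!mulrA ler_wpM2l// mulrA [v * _]mulrC mulrA ler_wpM2r.
Qed.

End Tmeans.

Section weak_type.
Context (R : realType) (m : nat -> nat) (m_ge2 : forall k, (2 <= m k)%N).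
Context (mu : probability (Gm m) R) (mu_prod : product_of_uniforms mu).

Lemma maximal_ge0 (f : nat -> Gm m -> R[i]) x : (0 <= maximal f x)%E.
Proof.
apply: le_trans (_ : (cmod (f 0%N x))%:E <= _)%E; first by rewrite lee_fin cmod_ge0.
by apply: ereal_sup_ubound; exists 0%N.
Qed.

Lemma measurable_maximal (f : nat -> Gm m -> R[i]) : (forall n, level n (f n)) ->
  measurable_fun setT (maximal f).
Proof.
move=> f_level.
have -> : maximal f = fun x => esups (fun n => (cmod (f n x))%:E) 0.
  apply/funext => x; rewrite /maximal /esups /sdrop; congr ereal_sup.
  by apply/seteqP; split => y [n _ <-]; exists n.
apply: (@measurable_fun_esups _ _ _ _ (fun n x => (cmod (f n x))%:E)) => n.
apply/measurable_EFinP; apply: (@measurable_fun_level m n) => x y xy.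
by rewrite (f_level n _ _ xy).
Qed.

Lemma mean_maxf_le (f : nat -> Gm m -> R[i]) L : (forall n, level n (f n)) ->
  ((mean L (fun t => Num.sqrt (maxf f L t)))%:E <=
   \int[mu]_x (`|maximal f x| `^ (1 / 2)))%E.
Proof.
move=> f_level; rewrite -(integral_level mu_prod); last first.
  by move=> t u tu; rewrite (level_maxf f_level tu).
have lm : level L (fun t => Num.sqrt (maxf f L t)).
  by move=> t u tu; rewrite (level_maxf f_level tu).
apply: ge0_le_integral => //.
- by apply/measurable_EFinP; exact: (@measurable_fun_level m L).
- apply: (measurableT_comp (measurable_poweR _)).
  by apply: measurableT_comp => //; exact: measurable_maximal.
move=> x _; rewrite gee0_abs ?maximal_ge0// -powR12_sqrt ?maxf_ge0// -poweR_EFin div1r.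
have maxf_le : ((maxf f L x)%:E <= maximal f x)%E.
  have := maximal_ge0 f x; have : forall n, ((cmod (f n x))%:E <= maximal f x)%E.
    by move=> n; apply: ereal_sup_ubound; exists n.
  case: (maximal f x) => [r| |] hn y0; [| by rewrite leey | by []].
  by rewrite lee_fin in y0; rewrite lee_fin; apply: bigmax_le => // n _; rewrite -lee_fin hn.
have half_ge0 : 0 <= (2^-1 : R) by rewrite invr_ge0.
refine (gt0_ler_poweR half_ge0 _ _ maxf_le); last by rewrite in_itv/= maximal_ge0 leey.
by rewrite in_itv/= lee_fin maxf_ge0 leey.
Qed.

Lemma level_partial_sum (f : nat -> Gm m -> R[i]) n L : (n <= vM m L)%N ->
  level L (partial_sum mu f n).
Proof.
move=> nL x y xy; apply: eq_big_nat => i /andP[_ ik].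
by rewrite (level_vilenkin R m_ge2 (leq_trans ik nL) xy).
Qed.

Lemma level_Tmean (f : nat -> Gm m -> R[i]) q n L : (n <= vM m L)%N ->
  level L (Tmean mu q f n).
Proof.
move=> nL x y xy.
have e k : (k < n)%N -> partial_sum mu f k x = partial_sum mu f k y.
  by move=> kn; exact: level_partial_sum (leq_trans (ltnW kn) nL) _ _ xy.
have {}e : \sum_(0 <= k < n) (q k)%:C%C * partial_sum mu f k x =
    \sum_(0 <= k < n) (q k)%:C%C * partial_sum mu f k y.
  by apply: eq_big_nat => k /andP[_ kn]; rewrite e.
rewrite /Tmean e; reflexivity.
Qed.

(** The set where [Tmax] exceeds [lam] is the increasing union of the sets [E L]
    on which this is already due to the means of order at most [vM m L.+1].
    On [E L] one of the Fejer means is large, by [cmod_Tmean_le], so that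
    [fejer_weak] bounds the measure of [E L] uniformly in [L]. *)
Lemma weak_type (q : nat -> R) : (exists B : nat, forall k, (m k <= B)%N) ->
  (forall k, 0 <= q k) -> 0 < q 0%N -> {homo q : i j / (i <= j)%N >-> i <= j} ->
  (fun n => q n.-1 / Qsum q n : R^o) =O_\oo (fun n => n%:R^-1 : R^o) ->
  exists C : R, forall f : nat -> Gm m -> R[i],
    Hardy mu (1 / 2) f ->
    (weakLnorm mu (1 / 2) (Tmax mu q f) <= C%:E * Hnorm mu (1 / 2) f)%E.
Proof.
move=> [B mB] q_ge0 q0 qm /(bounded_ratio q_ge0 q0 qm) [C1 C10 hC1].
pose K := weak_const R B * Num.sqrt (2 * C1).
have K0 : 0 <= K by rewrite !mulr_ge0// ?exprn_ge0 ?sqrtr_ge0.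
exists (K ^+ 2) => f [f_mart _].
have f_level n : level n (f n) by exact: martingale_level f_mart.
have f_avg n := martingale_avg m_ge2 mu_prod n f_mart.
set H := (\int[mu]_x (`|maximal f x| `^ (1 / 2)))%E.
have H0 : (0 <= H)%E by apply: integral_ge0 => x _; exact: poweR_ge0.
have half0 : (1 / 2 : R)^-1 = 2 by rewrite div1r invrK.
have -> : Hnorm mu (1 / 2) f = (H `^ 2)%E by rewrite /Hnorm unlock /= half0.
have -> : (((K ^+ 2)%:E) * H `^ 2 = (K%:E * H) `^ 2)%E.
  by rewrite poweRM ?lee_fin// poweR_EFin powR_mulrn.
rewrite /weakLnorm half0; refine (gt0_ler_poweR (ler0n _ 2) _ _ _).
- rewrite in_itv/= leey andbT; apply: le_trans (ereal_sup_ubound _); last first.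
    by exists 1 => //=; exact: ltr01.
  by rewrite mule_ge0 ?lee_fin ?powR_ge0.
- by rewrite in_itv/= leey andbT mule_ge0.
apply: ge_ereal_sup => _ [lam /= lam0 <-].
pose E L x := `[< exists n, [/\ (0 < n)%N, (n <= vM m L.+1)%N & lam < cmod (Tmean mu q f n x)] >].
have levE L : level L.+1 (E L).
  move=> x y xy.
  have Txy n : (n <= vM m L.+1)%N -> Tmean mu q f n x = Tmean mu q f n y.
    by move=> nL; exact: (@level_Tmean f q n L.+1 nL x y xy).
  by apply/idP/idP => /asboolP[n [n0 nL]]; [rewrite Txy// | rewrite -Txy//];
    move=> h; apply/asboolP; exists n.
have mE L : measurable ([set x | E L x] : set (Gm m)).
  by apply: (@measurable_level m L.+1) => x y xy; rewrite /mkset (levE L _ _ xy).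
have -> : [set x | (lam%:E < `|Tmax mu q f x|)%E] = \bigcup_L [set x | E L x].
  have T0 x : (0 <= Tmax mu q f x)%E.
    apply: le_trans (_ : (cmod (Tmean mu q f 1 x))%:E <= _)%E; first by rewrite lee_fin cmod_ge0.
    by apply: ereal_sup_ubound; exists 1%N.
  apply/seteqP; split => x /=; rewrite gee0_abs//.
    move=> /ereal_sup_gtP [_ [n /= n0 <-]]; rewrite lte_fin => h.
    exists n => //=; apply/asboolP; exists n; split => //.
    exact: leq_trans (ltnW (ltn_vM m_ge2 n)) (leq_vM m_ge2 (leqnSn n)).
  move=> [L _ /= /asboolP [n [n0 _ h]]]; apply: lt_le_trans (ereal_sup_ubound _); last first.
    by exists n; [exact: n0 | reflexivity].
  by rewrite lte_fin.
have EL L : ((powR lam (1 / 2))%:E * mu [set x | E L x] <= K%:E * H)%E.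
  rewrite (measure_level mu_prod (levE L)).
  apply: le_trans (lee_wpmul2l _ (mean_maxf_le L.+1 f_level)); last by rewrite lee_fin.
  rewrite -!EFinM lee_fin div1r powR12_sqrt ?(ltW lam0)//.
  have v0 : 0 < lam / (2 * C1) by rewrite divr_gt0// mulr_gt0.
  have hE x : E L x -> exists j, [/\ (0 < j)%N, (j <= vM m L.+1)%N &
      j%:R * (lam / (2 * C1)) < cmod (mean L.+1 (fun t => fejer R j x t * f L.+1 t))].
    move=> /asboolP [n [n0 nL lamT]]; apply: contrapT => no.
    move: lamT; rewrite ltNge => /negP; apply.
    have -> : lam = 2 * C1 * (lam / (2 * C1)) by rewrite mulrC divfK// gt_eqF// mulr_gt0.
    apply: (@cmod_Tmean_le _ _ q_ge0 q0 qm) (ltW v0) (hC1 n n0) _ => // j /andP[j0 jn].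
    rewrite leNgt; apply/negP => hj; apply: no; exists j; split => //.
      exact: leq_trans jn nL.
    by rewrite -(sum_partial_sum_mean m_ge2 mu_prod f_mart)// (leq_trans jn nL).
  apply: le_trans (ler_wpM2l (sqrtr_ge0 _) (fejer_weak m_ge2 mB f_level f_avg _ v0 hE)) _ => //.
  rewrite /K le_eqVlt; apply/orP; left; apply/eqP.
  rewrite sqrtrM ?(ltW lam0)// sqrtrV ?mulr_ge0 ?(ltW C10)//.
  field; rewrite !gt_eqF// sqrtr_gt0// mulr_gt0//.
have cvgE : (mu \o (fun L => [set x | E L x])) x @[x --> \oo] --> mu (\bigcup_L [set x | E L x]).
  apply: nondecreasing_cvg_mu => //; first exact: bigcupT_measurable.
  move=> L L' LL'; apply/subsetPset => x /= /asboolP [n [n0 nL h]]; apply/asboolP.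
  by exists n; split => //; exact: leq_trans nL (leq_vM m_ge2 (LL' : (L.+1 <= L'.+1)%N)).
have pl0 : 0 < powR lam (1 / 2) by rewrite powR_gt0.
rewrite -lee_pdivlMl// -(cvg_lim _ cvgE)//; apply: lime_le.
  by apply/cvg_ex; exists (mu (\bigcup_L [set x | E L x])).
by near=> L; rewrite lee_pdivlMl//; exact: EL.
Unshelve. all: by end_near. Qed.

End weak_type.

(** * The counterexample *)

Section adapted.
Context (R : realType) (m : nat -> nat) (m_ge2 : forall k, (2 <= m k)%N).
Context (mu : probability (Gm m) R) (mu_prod : product_of_uniforms mu).

Lemma integrable_level L (g : vseq m -> R) : level L g ->
  mu.-integrable [set: Gm m] (fun x => (g x)%:E).
Proof.
move=> gL; apply/integrableP; split.
  by apply/measurable_EFinP; exact: measurable_fun_level gL.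
rewrite (_ : (fun x => _) = (fun x => (`|g x|)%:E)); last by apply/funext.
rewrite (integral_level mu_prod (L := L)) ?ltry// => x y xy.
by rewrite (gL _ _ xy).
Qed.

Lemma cintegral_mkcond (A : set (Gm m)) (g : Gm m -> R[i]) :
  cintegral mu A g = cintegral mu setT (fun x => (x \in A)%:R * g x).
Proof.
rewrite /cintegral !(Rintegral_mkcond _ A); congr (_ +i* _)%C;
  apply: eq_Rintegral => x _; rewrite patchE;
  by case: (x \in A); rewrite ?mul1r ?mul0r.
Qed.

Lemma martingale_of_avg (f : nat -> Gm m -> R[i]) : (forall n, level n (f n)) ->
  (forall n, coordavg n (f n.+1) =1 (f n : vseq m -> R[i])) -> martingale mu f.
Proof.
move=> f_level f_avg; split=> [n|n|n k A nk /level_sigma lA].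
- exact/Fn_measurable_level.
- by split; apply: (@integrable_level n) => x y xy; rewrite (f_level _ _ _ xy).
have lA' : level n (fun x => (x \in A)%:R : R[i]).
  move=> x y xy; congr (nat_of_bool _)%:R.
  by apply/idP/idP => /set_mem h; apply/mem_set; [rewrite -(lA _ _ xy) | rewrite (lA _ _ xy)].
rewrite !(cintegral_mkcond A) (cintegral_level mu_prod (L := k)); last first.
  by move=> x y xy; rewrite (f_level _ _ _ xy) (lA' _ _ (agreeW nk xy)).
rewrite (cintegral_level mu_prod (L := n)); last first.
  by move=> x y xy; rewrite (f_level _ _ _ xy) (lA' _ _ xy).
rewrite (@meanMl_tower _ _ n)//; apply: mean_ext => x; congr (_ * _).
by have := avg_iota_martingale n (k - n) x f_avg; rewrite subnKC.
Qed.

End adapted.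

Section counterexample.
Context (R : realType) (m : nat -> nat) (m_ge2 : forall k, (2 <= m k)%N).
Context (mu : probability (Gm m) R) (mu_prod : product_of_uniforms mu).
Context (p : R) (p_gt0 : 0 < p) (p_lt : p < 1 / 2).

(** [growth] exceeds 1, but its power of exponent [p], which is [root_growth], is
    less than [2 `^ (1 - 2 * p)]. *)
Definition root_growth : R := 2 `^ ((1 - 2 * p) / 2).
Definition growth : R := root_growth `^ p^-1.
Definition amplitude k : R := growth ^+ k * (vM m k)%:R ^+ 2.

(** The exceptional index [k] is out of range: [x] belongs to the cylinder of
    rank [k] around 0. *)
Definition near0 k (x : vseq m) : bool := eq_except 0 k k (fun=> 0) x.

(** The increment of rank [k] is concentrated on the cylinder of rank [k] around 0.
    Its modulus there, [amplitude k], is just small enough for the powers of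
    exponent [p] to have summable integrals, see [powR_amplitude], and large
    enough for the Fourier coefficient of index [vM m k], which is
    [amplitude k / vM m k], to be of larger order than [vM m k]. *)
Definition bad_martingale n (x : Gm m) : R[i] :=
  \sum_(k < n) ((amplitude k * (near0 k x)%:R)%:C%C * rademacher R k x).

Lemma powR_exprn (a e : R) k : 0 <= a -> (a `^ e) ^+ k = (a ^+ k) `^ e.
Proof. by move=> a0; rewrite -powR_mulrn ?powR_ge0// -powRrM mulrC powRrM powR_mulrn. Qed.

Lemma leq_expn2_vM k : (2 ^ k <= vM m k)%N.
Proof. by elim: k => [|k ih]; rewrite ?vM0// expnS vMS mulnC leq_mul. Qed.

Lemma root_growth_gt1 : 1 < root_growth.
Proof.
have e0 : 0 < (1 - 2 * p) / 2 by have := p_lt; lra.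
rewrite /root_growth [ltLHS](_ : _ = 1 `^ ((1 - 2 * p) / 2)); last by rewrite powR1.
by apply: (gt0_ltr_powR e0); rewrite ?nnegrE ?ltr1n.
Qed.

Lemma growth_gt1 : 1 < growth.
Proof.
have v1 := root_growth_gt1; rewrite /growth [ltLHS](_ : _ = 1 `^ p^-1); last by rewrite powR1.
have e0 : 0 < p^-1 by rewrite invr_gt0.
by apply: (gt0_ltr_powR e0); rewrite ?nnegrE// ltW// (lt_trans _ v1).
Qed.

Lemma growth_gt0 : 0 < growth. Proof. exact: lt_trans growth_gt1. Qed.

Lemma amplitude_gt0 k : 0 < amplitude k.
Proof. by rewrite mulr_gt0 ?exprn_gt0 ?growth_gt0 ?ltr0n ?vM_gt0. Qed.

Lemma amplitude_double k : 2 * amplitude k <= amplitude k.+1.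
Proof.
rewrite /amplitude [growth ^+ k.+1]exprS vMS natrM.
have mk2 : 2 <= (m k)%:R :> R by rewrite ler_nat.
have g1 := growth_gt1; have a0 : 0 <= growth ^+ k by rewrite exprn_ge0// ltW// growth_gt0.
have gm : 0 <= growth * (m k)%:R ^+ 2 - 2 by nra.
rewrite -subr_ge0 [leRHS](_ : _ = growth ^+ k * (vM m k)%:R ^+ 2 *
  (growth * (m k)%:R ^+ 2 - 2)); last by ring.
by rewrite mulr_ge0// mulr_ge0// sqr_ge0.
Qed.

Lemma sum_amplitude n : \sum_(k < n.+1) amplitude k <= 2 * amplitude n.
Proof.
elim: n => [|n ih]; first by rewrite big_ord1; have := amplitude_gt0 0; lra.
by rewrite big_ord_recr/=; have := amplitude_double n; lra.
Qed.

Lemma level_near0 k : level k (near0 k).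
Proof. exact: (@level_eq_except m 0 k k (fun=> 0)). Qed.

Lemma level_rademacher k : level k.+1 (rademacher R k : vseq m -> R[i]).
Proof. by move=> x y xy; rewrite !rademacherE xy. Qed.

Lemma level_bad n : level n (bad_martingale n).
Proof.
move=> x y xy; apply: eq_bigr => k _.
by rewrite (level_near0 (agreeW (ltnW (ltn_ord k)) xy)) (level_rademacher (agreeW (ltn_ord k) xy)).
Qed.

Lemma bad_avg n : coordavg n (bad_martingale n.+1) =1 (bad_martingale n : vseq m -> R[i]).
Proof.
move=> x; rewrite /bad_martingale /coordavg.
under eq_bigr do rewrite big_ord_recr/=.
rewrite big_split/= mulrDr.
rewrite (_ : _ * \sum_d \sum_(k < n) _ = coordavg n (bad_martingale n) x)//.
rewrite coordavg_cst//; last by move=> d; apply/level_bad/agree_upd_out.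
rewrite [X in _ + X](_ : _ = 0) ?addr0//.
rewrite (eq_bigr (fun d => (amplitude n * (near0 n x)%:R)%:C%C * rademacher R n (upd x (k := n) d))).
  by rewrite -mulr_sumr sum_rademacher// !mulr0.
by move=> d _; rewrite (@level_near0 n (upd x d) x)//; exact: agree_upd_out.
Qed.

Lemma bad_is_martingale : martingale mu bad_martingale.
Proof. exact: martingale_of_avg level_bad bad_avg. Qed.

Lemma vilenkin_vM N (x : Gm m) : vilenkin R (vM m N) x = rademacher R N x.
Proof.
have := @vilenkinD R m m_ge2 N 1 0 x (m_ge2 N) (vM_gt0 m_ge2 N).
by rewrite mul1n addn0 => ->; rewrite /vilenkin big_ord0 mulr1 expr1.
Qed.

Lemma mean_near0 N : mean N (fun x => (near0 N x)%:R) = (vM m N)%:R^-1 :> R.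
Proof.
rewrite /mean avg_eq_except// /vM natr_prod -prodfV -(big_mkord xpredT (fun k => (m k)%:R^-1)).
rewrite /index_iota subn0; apply: eq_big_seq => k; rewrite mem_iota => /andP[_ kN].
by rewrite ltn_eqF.
Qed.

Lemma fourier_bad N : fourier mu bad_martingale (vM m N) = (growth ^+ N * (vM m N)%:R)%:C%C.
Proof.
have NS : (vM m N < vM m N.+1)%N.
  by rewrite vMS -[ltnLHS]muln1 ltn_pmul2l ?vM_gt0.
rewrite (fourier_mean m_ge2 mu_prod bad_is_martingale NS).
rewrite (@mean_tower _ _ N)// subSnn.
rewrite (@mean_ext _ _ _ _ (fun x => (amplitude N * (near0 N x)%:R)%:C%C)); last first.
  move=> x; rewrite /= /coordavg.
  rewrite (eq_bigr (fun d : 'Z_(m N) => bad_martingale N x * (rademacher R N (upd x d))^*%C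
      + (amplitude N * (near0 N x)%:R)%:C%C)); last first.
    move=> d _; have xd : agree N (upd x d) x by exact: agree_upd_out.
    rewrite vilenkin_vM /bad_martingale big_ord_recr/= -/(bad_martingale N _).
    rewrite mulrDl (level_bad xd) (level_near0 xd); congr (_ + _).
    by rewrite -mulrA cmod1_conj ?mulr1// cmod_rademacher.
  have r0 : \sum_(d : 'Z_(m N)) (rademacher R N (upd x d))^*%C = 0.
    transitivity ((\sum_(d : 'Z_(m N)) rademacher R N (upd x d))^*%C).
      by rewrite rmorph_sum.
    by rewrite sum_rademacher// rmorph0.
  rewrite big_split/= -mulr_sumr r0 mulr0 add0r.
  by rewrite sumr_const card_Zm// -[X in _ * X]mulr_natl mulKf ?mkF_neq0.
transitivity (((amplitude N * mean N (fun x => (near0 N x)%:R))%:C)%C : R[i]).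
  rewrite -meanZ; apply/eqP; rewrite eq_complex /mean Re_avg Im_avg /= eqxx/=.
  by rewrite avg0.
rewrite mean_near0 /amplitude expr2 mulrA mulfK// vM_neq0//.
Qed.

Lemma powR_amplitude k :
  (2 * amplitude k) `^ p / (vM m k)%:R <= 2 `^ p * root_growth^-1 ^+ k.
Proof.
have v1 := root_growth_gt1; have v0 : 0 < root_growth := lt_trans ltr01 v1.
have M0 : 0 < (vM m k)%:R :> R by rewrite ltr0n vM_gt0.
have g0 := growth_gt0.
rewrite powRM ?(ltW (amplitude_gt0 _))// -mulrA ler_wpM2l ?powR_ge0//.
rewrite /amplitude powRM ?exprn_ge0 ?(ltW g0)//.
have -> : (growth ^+ k) `^ p = root_growth ^+ k.
  by rewrite powR_exprn ?(ltW v0)// -powRrM mulVf ?gt_eqF// powRr1// exprn_ge0// ltW.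
have M1 : ((vM m k)%:R ^+ 2) `^ p * (vM m k)%:R `^ (1 - 2 * p) = (vM m k)%:R :> R.
  rewrite -powR_mulrn// -powRrM -powRD; last by rewrite (gt_eqF M0) implybT.
  by rewrite addrC subrK powRr1// ltW.
have w : root_growth ^+ k * root_growth ^+ k <= (vM m k)%:R `^ (1 - 2 * p) :> R.
  have h0 : (2 ^+ k : R) != 0 by rewrite expf_neq0// pnatr_eq0.
  rewrite {1 2}/root_growth powR_exprn// -powRD; last by rewrite h0 implybT.
  rewrite -splitr; apply: ge0_ler_powR; rewrite ?nnegrE ?exprn_ge0 ?(ltW M0)//.
    by have := p_lt; lra.
  by rewrite -natrX ler_nat leq_expn2_vM.
rewrite exprVn ler_pdivrMr// ler_pdivlMl ?exprn_gt0//.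
rewrite -[leRHS]M1 [leRHS]mulrC mulrA ler_wpM2r// powR_ge0//.
Qed.

(** The amplitudes grow geometrically, so the last increment that does not vanish
    at [x] dominates. *)
Lemma bad_near0 n x : (0 < n)%N -> exists s, near0 s x /\
  cmod (bad_martingale n x) <= 2 * amplitude s.
Proof.
move=> n0; have near00 : near0 0 x by [].
have [s [sx hs]] : exists s, near0 s x /\
    \sum_(k < n) amplitude k * (near0 k x)%:R <= 2 * amplitude s.
  case: n n0 => // n _; elim: n => [|n [s [sx ih]]].
    exists 0%N; split => //; rewrite big_ord1 near00 mulr1.
    by have := amplitude_gt0 0; lra.
  case: (boolP (near0 n.+1 x)) => [nx|/negbTE nx]; last first.
    by exists s; rewrite big_ord_recr/= nx mulr0 addr0.
  exists n.+1; split => //; apply: le_trans (sum_amplitude n.+1); apply: ler_sum => k _.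
  by rewrite ler_piMr ?(ltW (amplitude_gt0 _))// lern1 leq_b1.
exists s; split => //; apply: le_trans (cmod_sum _ _ _) _; apply: le_trans hs.
apply: ler_sum => k _; rewrite cmodM cmod_rademacher// mulr1 cmod_real ger0_norm//.
by rewrite mulr_ge0// ltW// amplitude_gt0.
Qed.

Lemma bad_Hardy : Hardy mu p bad_martingale.
Proof.
split; first exact: bad_is_martingale.
pose g s (x : Gm m) : \bar R := ((2 * amplitude s) `^ p * (near0 s x)%:R)%:E.
have g0 s x : (0 <= g s x)%E by rewrite lee_fin mulr_ge0 ?powR_ge0.
pose G x := (\sum_(0 <= s <oo) g s x)%E.
have G0 x : (0 <= G x)%E by exact: nneseries_ge0.
have lg s : level s (fun x : vseq m => (2 * amplitude s) `^ p * (near0 s x)%:R).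
  by move=> x y xy; rewrite (level_near0 xy).
have mg s : measurable_fun setT (g s).
  by apply/measurable_EFinP; exact: (@measurable_fun_level m s).
have fG x : (`|maximal bad_martingale x| `^ p <= G x)%E.
  rewrite gee0_abs ?maximal_ge0// -[leRHS](poweRe1 (G0 x)) -(mulVf (lt0r_neq0 p_gt0)) poweRrM.
  refine (gt0_ler_poweR (ltW p_gt0) _ _ _); rewrite ?in_itv/= ?leey ?maximal_ge0 ?poweR_ge0//.
  apply: ge_ereal_sup => _ [n _ <-].
  have [->|n0] := posnP n; first by rewrite /bad_martingale big_ord0 cmod0 poweR_ge0.
  have [s [sx hs]] := bad_near0 x n0.
  have : (((2 * amplitude s) `^ p)%:E <= G x)%E.
    apply: le_trans (_ : g s x <= _)%E; first by rewrite /g sx mulr1.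
    apply: le_trans (nneseries_lim_ge s.+1 _); last by move=> k _ _; exact: g0.
    by rewrite big_nat_recr//= leeDr// sume_ge0.
  move=> hG; apply: le_trans (_ : (2 * amplitude s)%:E <= _)%E; first by rewrite lee_fin.
  have a0 : 0 <= 2 * amplitude s by rewrite mulr_ge0// ltW// amplitude_gt0.
  have -> : (2 * amplitude s)%:E = ((((2 * amplitude s) `^ p)%:E) `^ p^-1)%E.
    by rewrite poweR_EFin -powRrM divff ?gt_eqF// powRr1.
  refine (gt0_ler_poweR _ _ _ hG); first by rewrite invr_ge0 ltW.
    by rewrite in_itv/= leey lee_fin powR_ge0.
  by rewrite in_itv/= leey G0.
rewrite /Hnorm unlock /=; apply: poweR_lty.
have v1 := root_growth_gt1; have v0 : 0 < root_growth := lt_trans ltr01 v1.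
apply: (@le_lt_trans _ _ (2 `^ p / (1 - root_growth^-1))%:E); last exact: ltry.
apply: (@le_trans _ _ (\int[mu]_x G x)%E).
  apply: ge0_le_integral => //.
  - by move=> x _; exact: poweR_ge0.
  - apply: (measurableT_comp (measurable_poweR _)).
    by apply: measurableT_comp => //; exact: measurable_maximal level_bad.
  - by apply: ge0_emeasurable_sum => //.
rewrite integral_nneseries//.
apply: lime_le; first by apply: is_cvg_nneseries => n _ _; exact: integral_ge0.
near=> n; rewrite big_mkord.
rewrite (eq_bigr (fun s : 'I_n => ((2 * amplitude s) `^ p / (vM m s)%:R)%:E)); last first.
  by move=> s _; rewrite (integral_level mu_prod (lg s)) meanZ mean_near0.
rewrite sumEFin lee_fin.
apply: (@le_trans _ _ (\sum_(s < n) 2 `^ p * root_growth^-1 ^+ s)).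
  by apply: ler_sum => s _; exact: powR_amplitude.
rewrite -mulr_sumr ler_wpM2l ?powR_ge0//.
by apply: geo_sum_le; rewrite ?invr_ge0 ?(ltW v0)// invf_lt1.
Unshelve. all: by end_near. Qed.

(** ** Unboundedness *)

Lemma weakLnorm_measure_le (g : Gm m -> \bar R) (K lam : R) : 0 <= K -> 0 < lam ->
  (weakLnorm mu p g <= K%:E)%E ->
  ((lam `^ p)%:E * mu [set x | lam%:E < `|g x|] <= (K `^ p)%:E)%E.
Proof.
move=> K0 lam0; rewrite /weakLnorm; set S := ereal_sup _ => SK.
have tS : ((lam `^ p)%:E * mu [set x | lam%:E < `|g x|] <= S)%E.
  by apply: ereal_sup_ubound; exists lam.
apply: (le_trans tS); have S0 : (0 <= S)%E.
  by apply: le_trans tS; rewrite mule_ge0 ?lee_fin ?powR_ge0.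
rewrite -[leLHS](poweRe1 S0) -(mulVf (lt0r_neq0 p_gt0)) poweRrM -poweR_EFin.
by refine (gt0_ler_poweR (ltW p_gt0) _ _ SK); rewrite in_itv/= leey andbT ?poweR_ge0.
Qed.

Lemma bernoulli (g : R) n : 1 <= g -> 1 + n%:R * (g - 1) <= g ^+ n.
Proof.
move=> g1; elim: n => [|n ih]; first by rewrite mul0r addr0.
rewrite exprS -natr1; have n0 : 0 <= n%:R :> R by [].
have : g * (1 + n%:R * (g - 1)) <= g * g ^+ n by rewrite ler_wpM2l//; lra.
have : 0 <= n%:R * (g - 1) * (g - 1) by rewrite !mulr_ge0// subr_ge0.
lra.
Qed.

(** If the means were bounded in weak [L_p], then, for every [N], those of orders
    [vM m N], [vM m N + 1] and [vM m N + 2] would be at most [lam] at a common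
    point, with [lam] independent of [N]. Differences of [Qsum q n * T n] give
    [q n * S_n], and [Qsum q n.+1 <= n.+1 * q n], so two consecutive partial
    sums would be of order [vM m N * lam] there. Their difference is a single
    term, of modulus [growth ^+ N * vM m N]. *)
Lemma bad_unbounded (q : nat -> R) :
  (forall k, 0 <= q k) -> 0 < q 0%N -> {homo q : i j / (i <= j)%N >-> i <= j} ->
  ereal_sup [set weakLnorm mu p (fun x => (cmod (Tmean mu q bad_martingale n x))%:E) |
             n in [set n | (0 < n)%N]] = +oo%E.
Proof.
move=> q_ge0 q0 qm; set S := ereal_sup _; apply/eqP; rewrite -leye_eq leNgt.
apply/negP => Slt; pose f := bad_martingale; pose T n := Tmean mu q f n.
have S0 : (0 <= S)%E.
  apply: le_trans (ereal_sup_ubound _); last by exists 1%N.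
  exact: poweR_ge0.
have SK : S = (fine S)%:E by rewrite fineK// ge0_fin_numE.
pose K := fine S; have K0 : 0 <= K by rewrite fine_ge0.
have TK n : (0 < n)%N -> (weakLnorm mu p (fun x => (cmod (T n x))%:E) <= K%:E)%E.
  by move=> n0; rewrite -SK; apply: ereal_sup_ubound; exists n.
(* With this [lam], each mean exceeds [lam] on a set of measure at most [1 / 4]. *)
pose lam := (4 * K `^ p + 1) `^ p^-1.
have h0 : 0 < 4 * K `^ p + 1 by rewrite ltr_wpDl// mulr_ge0 ?powR_ge0.
have lam0 : 0 < lam by rewrite powR_gt0.
have lamp : lam `^ p = 4 * K `^ p + 1.
  by rewrite /lam -powRrM mulVf ?gt_eqF// powRr1// ltW.
pose E n := [set x : Gm m | lam < cmod (T n x)].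
have mE n : measurable (E n).
  apply: (@measurable_level m n) => x y xy; rewrite /E /mkset /T.
  by rewrite (level_Tmean m_ge2 mu f q (ltnW (ltn_vM m_ge2 n)) xy).
have muE n : (0 < n)%N -> (mu (E n) <= (1 / 4)%:E)%E.
  move=> n0; have := weakLnorm_measure_le K0 lam0 (TK n n0).
  rewrite lamp (_ : [set x | _] = E n); last first.
    by apply/seteqP; split => x; rewrite /E /= lte_fin ger0_norm ?cmod_ge0.
  rewrite -lee_pdivlMl// => /le_trans; apply; rewrite -EFinM lee_fin mulrC.
  by rewrite ler_pdivrMr//; have := powR_ge0 K p; lra.
have point N : exists x, [/\ cmod (T (vM m N) x) <= lam, cmod (T (vM m N).+1 x) <= lam
    & cmod (T (vM m N).+2 x) <= lam].
  apply: contrapT => no; set n := vM m N in no.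
  have n0 : (0 < n)%N by exact: vM_gt0.
  have : (mu setT <= mu (E n `|` E n.+1 `|` E n.+2))%E.
    apply: le_measure; rewrite ?inE//; first by do 2 apply: measurableU => //.
    move=> x _; apply: contrapT => nE; apply: no; exists x.
    by split; rewrite leNgt; apply/negP => h; apply: nE; [left; left | left; right | right].
  rewrite probability_setT => h1.
  have h2 := measureU2 mu (measurableU _ _ (mE n) (mE n.+1)) (mE n.+2).
  have h3 := measureU2 mu (mE n) (mE n.+1).
  have := le_trans h1 (le_trans h2 (leeD (le_trans h3 (leeD (muE n n0) (muE n.+1 isT))) (muE n.+2 isT))).
  by rewrite -!EFinD lee_fin; lra.
have SE n x : (0 < n)%N -> cmod (T n x) <= lam -> cmod (T n.+1 x) <= lam ->
    cmod (partial_sum mu f n x) <= 2 * (n.+1%:R * lam).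
  move=> n0 Tn Tn1.
  have QT k : (0 < k)%N -> (Qsum q k)%:C%C * T k x =
      \sum_(0 <= i < k) (q i)%:C%C * partial_sum mu f i x.
    move=> k0; rewrite /T /Tmean mulrA -rmorphM mulfV ?gt_eqF ?mul1r//.
    exact: Qsum_gt0.
  have qn : 0 < q n := q_gt0 q0 qm n.
  have e : (q n)%:C%C * partial_sum mu f n x = (Qsum q n.+1)%:C%C * T n.+1 x - (Qsum q n)%:C%C * T n x.
    by rewrite !QT// big_nat_recr//= [RHS]addrC addKr.
  have Qn := Qsum_gt0 q_ge0 q0 n0; have Qn1 := @Qsum_gt0 _ _ q_ge0 q0 n.+1 isT.
  rewrite -(ler_pM2l qn) -[X in X * cmod _](ger0_norm (ltW qn)) -cmod_real -cmodM e.
  have cT k : 0 < Qsum q k -> cmod ((Qsum q k)%:C%C * T k x) = Qsum q k * cmod (T k x).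
    by move=> Qk; rewrite cmodM cmod_real ger0_norm// ltW.
  apply: le_trans (cmodB _ _) _; rewrite (cT _ Qn) (cT _ Qn1).
  have hQ : Qsum q n.+1 <= n.+1%:R * q n := Qsum_le qm n.+1.
  have hQn : Qsum q n <= n.+1%:R * q n by apply: le_trans hQ; rewrite QsumS lerDl.
  have b1 : Qsum q n.+1 * cmod (T n.+1 x) <= n.+1%:R * q n * lam.
    by rewrite ler_pM ?cmod_ge0// ltW.
  have b2 : Qsum q n * cmod (T n x) <= n.+1%:R * q n * lam.
    by rewrite ler_pM ?cmod_ge0// ltW.
  apply: le_trans (lerD b1 b2) _; rewrite le_eqVlt; apply/orP; left; apply/eqP.
  by ring.
have bound N : growth ^+ N <= 12 * lam.
  have [x [x0 x1 x2]] := point N; set n := vM m N in x0 x1 x2.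
  have n0 : (0 < n)%N by exact: vM_gt0.
  have e : partial_sum mu f n.+1 x - partial_sum mu f n x = fourier mu f n * vilenkin R n x.
    by rewrite /partial_sum big_nat_recr//= [LHS]addrC addKr.
  have := cmodB (partial_sum mu f n.+1 x) (partial_sum mu f n x).
  rewrite e cmodM cmod_vilenkin// mulr1 fourier_bad cmod_real ger0_norm; last first.
    by rewrite mulr_ge0// exprn_ge0// ltW// growth_gt0.
  have s1 := SE n x n0 x0 x1; have s2 := SE n.+1 x isT x1 x2.
  have nR : 1 <= n%:R :> R by rewrite ler1n.
  move=> h; rewrite -(ler_pM2r (_ : 0 < n%:R :> R)) ?ltr0n//.
  apply: le_trans h (le_trans (lerD s2 s1) _).
  rewrite -![_.+1%:R]natr1.
  have : 0 <= lam * (n%:R - 1) by rewrite mulr_ge0 ?subr_ge0// ltW.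
  lra.
have g1 := growth_gt1; have g10 : 0 < growth - 1 by rewrite subr_gt0.
pose N := (Num.truncn (12 * lam / (growth - 1))).+1.
have := le_trans (bernoulli N (ltW g1)) (bound N).
have := truncnS_gt (12 * lam / (growth - 1)); rewrite -/N ltr_pdivrMr//.
lra.
Qed.

End counterexample.

Theorem theorem2 (R : realType) (m : nat -> nat)
    (m_ge2 : forall k, (2 <= m k)%N)
    (m_bounded : exists B : nat, forall k, (m k <= B)%N)
    (mu : probability (Gm m) R)
    (mu_prod : product_of_uniforms mu) :
  (forall q : nat -> R,
     (forall k, 0 <= q k) -> 0 < q 0%N ->
     {homo q : i j / (i <= j)%N >-> i <= j} ->
     (fun n => q n.-1 / Qsum q n : R^o) =O_\oo (fun n => n%:R^-1 : R^o) ->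
     exists C : R, forall f : nat -> Gm m -> R[i],
       Hardy mu (1 / 2) f ->
       (weakLnorm mu (1 / 2) (Tmax mu q f) <= C%:E * Hnorm mu (1 / 2) f)%E) /\
  (forall p : R, 0 < p -> p < 1 / 2 ->
   forall q : nat -> R,
     (forall k, 0 <= q k) -> 0 < q 0%N ->
     {homo q : i j / (i <= j)%N >-> i <= j} ->
     exists f : nat -> Gm m -> R[i],
       Hardy mu p f /\
       ereal_sup [set weakLnorm mu p (fun x => (cmod (Tmean mu q f n x))%:E) |
                  n in [set n | (0 < n)%N]] = +oo%E).
Proof.
split=> [q q_ge0 q0 q_mono|p p0 p_lt q q_ge0 q0 q_mono].
  exact: weak_type.
exists (bad_martingale p); split; first exact: bad_Hardy.
exact: bad_unbounded.
Qed.
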